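(* Let $r\in\mathbb{N}$, $\alpha>1$, $a>0$ and $c\in\mathbb{R}$ with $a+c>0$. Let $$A^r_{c,a}=\Big\{\xi\in\mathbb{D}:\sup_{t\in[0,1]}\{\xi(t)-ct-\mathfrak{J}^r_\xi(t)\}\ge a\Big\},$$ $$\mathcal{A}^r_{c,a}=\Big\{\xi\in\mathbb{D}:\sup_{t\in[0,1]}\{\xi(t)-ct-(r+1)\mathfrak{J}^r_\xi(t)+r\,\mathfrak{J}^{r+1}_\xi(t)\}\ge a\Big\}.$$ Then the constants $\mathcal{C}^L_{r+1}:=C_{r+1}(A^r_{c,a})$ and $\mathcal{C}^E_{r+1}:=C_{r+1}(\mathcal{A}^r_{c,a})$ are given by $$\mathcal{C}^L_{r+1}=\frac{1}{(r+1)!}\times\begin{cases}a^{-(r+1)\alpha}\;{}_2F_1\big(r+1,(r+1)\alpha;\,r+2;\,-c/a\big), & c>0,\\ (a+c)^{-(r+1)\alpha}, & c<0,\end{cases}$$ $$\mathcal{C}^E_{r+1}=\frac{(r+1)^{(r+1)\alpha}}{(r+1)!}\times\begin{cases}a^{-(r+1)\alpha}\;{}_2F_1\big(r+1,(r+1)\alpha;\,r+2;\,-c/a\big), & c>0,\\ (a+c)^{-(r+1)\alpha}, & c<0.\end{cases}$$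
   Context: $\mathbb{D}$ is the space of real-valued càdlàg functions on $[0,1]$ with the Skorokhod $J_1$ topology. For $\xi\in\mathbb{D}$ and $m\in\mathbb{N}=\{1,2,\dots\}$, $$\mathfrak{J}^m_\xi(t)=\sup\Big\{\sum_{i=1}^m\big(\xi(s_i)-\xi(s_i^-)\big):\ (s_1,\dots,s_m)\in[0,t]^m,\ s_i\ne s_j\ \text{for } i\neq j\Big\},\quad t\in(0,1],$$ and $\mathfrak{J}^m_\xi(0)=0$, with $\xi(s^-)$ the left limit of $\xi$ at $s$ and the convention $\xi(0^-)=\xi(0)$. Let $\nu_\alpha$ be the measure on $(0,\infty)$ with $\nu_\alpha(x,\infty)=x^{-\alpha}$ for $x>0$, and let $\nu_\alpha^j$ be the restriction to $\{x\in\mathbb{R}_+^j: x_1\ge x_2\ge\dots\ge x_j>0\}$ of the $j$-fold product measure of $\nu_\alpha$. For $j\ge1$ the measure $C_j$ on $\mathbb{D}$ is $$C_j(\bullet)=\mathbb{E}\Big[\nu_\alpha^j\Big\{y\in\mathbb{R}_+^j:\sum_{i=1}^j y_i\,\mathbf{1}_{[U_i,1]}\in\bullet\Big\}\Big],$$ where $U_1,\dots,U_j$ are i.i.d. uniform on $[0,1]$ and $\mathbf{1}_B$ denotes the indicator function of $B$. ${}_2F_1(b,e;d;z)=\sum_{k=0}^\infty \frac{(b)_k(e)_k}{(d)_k}\frac{z^k}{k!}$ is the hypergeometric function, with Pochhammer symbol $(b)_k=b(b+1)\cdots(b+k-1)$; for $z\le-1$ it is understood through its analytic continuation to $\mathbb{C}\setminus[1,\infty)$.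 *)

(* Defs.v *)
From HB Require Import structures.
From mathcomp Require Import all_boot all_order all_algebra.
From mathcomp Require Import all_classical all_reals all_analysis.
From mathcomp Require Import complex.

Set Implicit Arguments.
Unset Strict Implicit.
Unset Printing Implicit Defensive.

Import Order.TTheory GRing.Theory Num.Theory.
Import numFieldNormedType.Exports.

Local Open Scope classical_set_scope.
Local Open Scope ring_scope.
Local Open Scope complex_scope.

Definition clamp {R : realType} (t : R) : R := Num.max 0 (Num.min t 1).

(* A cadlag function on [0,1] is encoded by its extension to the real line that
   is constant on ]-oo,0] and on [1,+oo[. Equality of encodings is equality of
   functions on [0,1], and the left limit at 0 of the encoding is the value at 0,
   as required by the convention xi(0^-) = xi(0). *)
Record cadlag (R : realType) := Cadlag {
  cadlag_fun :> R -> R;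
  cadlag_clamp : forall t, cadlag_fun t = cadlag_fun (clamp t);
  cadlag_right : forall t, 0 <= t < 1 ->
    cadlag_fun x @[x --> t^'+] --> cadlag_fun t;
  cadlag_left : forall t, 0 < t <= 1 -> cvg (cadlag_fun x @[x --> t^'-]) }.

HB.instance Definition _ (R : realType) := gen_eqMixin (cadlag R).
HB.instance Definition _ (R : realType) := gen_choiceMixin (cadlag R).

Section skorokhod_J1.
Context {R : realType}.

Definition time_change (lam : R -> R) :=
  [/\ {within `[0, 1], continuous lam}, lam 0 = 0, lam 1 = 1 &
      {in `[0, 1] &, forall s t, s < t -> lam s < lam t}].

Definition J1_ball (xi : cadlag R) (e : R) : set (cadlag R) :=
  [set eta | exists2 lam, time_change lam &
     exists2 e', e' < e & forall t, 0 <= t <= 1 ->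
       `|lam t - t| <= e' /\ `|xi t - eta (lam t)| <= e'].

Definition J1_open (A : set (cadlag R)) :=
  forall xi, A xi -> exists2 e, 0 < e & J1_ball xi e `<=` A.

Let J1_openT : J1_open setT.
Proof. by move=> xi _; exists 1. Qed.

Let J1_openI A B : J1_open A -> J1_open B -> J1_open (A `&` B).
Proof.
move=> oA oB xi [/oA[e1 e10 h1] /oB[e2 e20 h2]].
exists (Num.min e1 e2); first by rewrite lt_min e10.
move=> eta [lam hlam [e']]; rewrite lt_min => /andP[e'1 e'2] he'.
by split; [apply: h1|apply: h2]; exists lam => //; exists e'.
Qed.

Let J1_open_bigcup (I : Type) (f : I -> set (cadlag R)) :
  (forall i, J1_open (f i)) -> J1_open (\bigcup_i f i).
Proof.
move=> of_ xi [i _ /of_[e e0 he]]; exists e => // eta /he fi.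
by exists i.
Qed.

HB.instance Definition _ := @isOpenTopological.Build (cadlag R) J1_open
  J1_openT J1_openI J1_open_bigcup.

End skorokhod_J1.

Section step_path.
Context {R : realType}.

Lemma clamp_in (t : R) : 0 <= t <= 1 -> clamp t = t.
Proof. by move=> /andP[t0 t1]; rewrite /clamp min_l// max_r. Qed.

Lemma clamp_id (t : R) : clamp (clamp t) = clamp t.
Proof.
apply: clamp_in; rewrite /clamp le_max lexx ge_max ler01 /=.
by rewrite ge_min lexx orbT.
Qed.

Lemma indic_clampE (u t : R) :
  \1_(`[u, 1] : set R) (clamp t) = (u <= clamp t)%R%:R :> R.
Proof.
rewrite indicE mem_setE in_itv/=; congr (nat_of_bool _)%:R.
suff -> : clamp t <= 1 by rewrite andbT.
by rewrite /clamp ge_max ler01 ge_min lexx orbT.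
Qed.

Variables (j : nat) (u : 'I_j -> R) (y : j.-tuple R).

Definition step_fun (t : R) : R :=
  \sum_(i < j) tnth y i * \1_(`[u i, 1] : set R) (clamp t).

Let step_clamp t : step_fun t = step_fun (clamp t).
Proof. by rewrite /step_fun; under [RHS]eq_bigr do rewrite clamp_id. Qed.

Let step_right t : 0 <= t < 1 -> step_fun x @[x --> t^'+] --> step_fun t.
Proof.
move=> /andP[t0 t1]; apply: cvg_near_cst.
suff : \forall x \near t^'+, forall i, (u i <= clamp x) = (u i <= clamp t).
  by apply: filterS => x ux; apply: eq_bigr => i _; rewrite !indic_clampE ux.
apply: filter_forall => i; rewrite (@clamp_in t); last by rewrite t0 ltW.
have clampE : \forall x \near t^'+, clamp x = x.
  near=> x; apply/clamp_in/andP; split; last by near: x; exact: nbhs_right_le.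
  by apply: le_trans t0 _; near: x; exact: nbhs_right_ge.
have [ut|tu] := leP (u i) t; near=> x; rewrite (near clampE x)//.
  by apply: le_trans ut _; near: x; exact: nbhs_right_ge.
by apply/negbTE; rewrite -ltNge; near: x; exact: nbhs_right_lt.
Unshelve. all: by end_near. Qed.

Let step_left t : 0 < t <= 1 -> cvg (step_fun x @[x --> t^'-]).
Proof.
move=> /andP[t0 t1].
apply: (is_cvg_near_cst (\sum_(i < j) tnth y i * (u i < t)%R%:R)).
suff : \forall x \near t^'-, forall i, (u i <= clamp x) = (u i < t).
  by apply: filterS => x ux; apply: eq_bigr => i _; rewrite !indic_clampE ux.
have clampE : \forall x \near t^'-, clamp x = x.
  near=> x; apply/clamp_in/andP; split; first by near: x; exact: nbhs_left_ge.
  by apply: le_trans t1; near: x; exact: nbhs_left_le.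
apply: filter_forall => i; have [ut|tu] := ltP (u i) t; near=> x;
  rewrite (near clampE x)//; first by near: x; exact: nbhs_left_ge.
apply/negbTE; rewrite -ltNge; apply: lt_le_trans tu.
by near: x; exact: nbhs_left_lt.
Unshelve. all: by end_near. Qed.

Definition step_path : cadlag R := Cadlag step_clamp step_right step_left.

End step_path.

Section large_jumps.
Context {R : realType}.

Definition jump (xi : cadlag R) (s : R) : R := xi s - lim (xi x @[x --> s^'-]).

(* Cadlag functions on [0,1] are bounded, so that the suprema below are suprema
   of bounded nonempty sets, except in the case t = 0 treated apart. *)
Definition top_jumps (m : nat) (xi : cadlag R) (t : R) : R :=
  if t == 0 then 0 else
  sup [set \sum_(i < m) jump xi (s i) | s in
       [set s : 'I_m -> R | (forall i, 0 <= s i <= t) /\ injective s]].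

Definition exceedL (r : nat) (c a : R) : set (cadlag R) :=
  [set xi : cadlag R |
     a <= sup [set xi t - c * t - top_jumps r xi t | t in `[0, 1]]].

Definition exceedE (r : nat) (c a : R) : set (cadlag R) :=
  [set xi : cadlag R |
     a <= sup [set xi t - c * t - r.+1%:R * top_jumps r xi t
                 + r%:R * top_jumps r.+1 xi t | t in `[0, 1]]].

End large_jumps.

Section limit_measure.
Context {R : realType}.

Definition is_nu (alpha : R) (nu : {measure set (measurableTypeR R) -> \bar R}) :=
  nu `]-oo, 0]%classic = 0%E /\
  forall x, 0 < x -> nu `]x, +oo[%classic = (x `^ (- alpha))%:E.

(* j-fold product measure: iterates the formula by which the library defines the
   binary product of measures *)
Fixpoint product_power (nu : {measure set (measurableTypeR R) -> \bar R}) (j : nat) :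
    set (j.-tuple R) -> \bar R :=
  match j with
  | 0 => fun B => \d_([tuple] : 0.-tuple R) B
  | j'.+1 => fun B => (\int[nu]_x product_power nu
                         [set y : j'.-tuple R | B [tuple of x :: y]])%E
  end.

Definition ordered_orthant (j : nat) : set (j.-tuple R) :=
  [set y | (forall i, 0 < tnth y i) /\
           (forall i k : 'I_j, (i <= k)%N -> tnth y k <= tnth y i)].

Definition nu_ordered (nu : {measure set (measurableTypeR R) -> \bar R}) (j : nat)
    (B : set (j.-tuple R)) : \bar R :=
  product_power nu (B `&` @ordered_orthant j).

Definition iid_uniform (d : measure_display) (T : measurableType d)
    (P : probability T R) (j : nat) (U : 'I_j -> {RV P >-> R}) :=
  (forall i (B : set R), measurable B ->
     distribution P (U i) B = uniform_prob (@ltr01 R) B) /\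
  (forall B : 'I_j -> set R, (forall i, measurable (B i)) ->
     P (\bigcap_i (U i @^-1` B i)) = (\prod_(i < j) P (U i @^-1` B i))%E).

Definition Cmeas (d : measure_display) (T : measurableType d)
    (P : probability T R) (j : nat) (U : 'I_j -> {RV P >-> R})
    (nu : {measure set (measurableTypeR R) -> \bar R}) (B : set (cadlag R)) : \bar R :=
  (\int[P]_w nu_ordered nu
     [set y : j.-tuple R | B (step_path (fun i => U i w) y)])%E.

End limit_measure.

Section hypergeometric.
Context {R : realType}.

Definition poch (b : R[i]) (k : nat) : R[i] := \prod_(i < k) (b + i%:R).

(* sum_k u_k = l in the complex plane *)
Definition csums (u : nat -> R[i]) (l : R[i]) :=
  (series u : nat -> R[i]^o) @ \oo --> (l : R[i]^o).

Definition analytic_at (F : R[i] -> R[i]) (z0 : R[i]) :=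
  exists a : nat -> R[i], exists2 rho : R, 0 < rho &
    forall z, `|z - z0| < rho%:C ->
      csums (fun n => a n * (z - z0) ^+ n) (F z).

(* F is the function 2F1(b, e; d; .) continued analytically to the complex plane
   cut along [1, +oo[. In the partial order of R[i], 1 <= z means that z is real
   and at least 1. *)
Definition is_2F1 (b e d : R[i]) (F : R[i] -> R[i]) :=
  (forall z, `|z| < 1 ->
     csums (fun k => poch b k * poch e k / poch d k * (z ^+ k / k`!%:R)) (F z)) /\
  (forall z, ~~ (1 <= z) -> analytic_at F z).

End hypergeometric.

(* Main.v *)
Require Import Defs.
From mathcomp Require Import all_boot all_order all_algebra.
From mathcomp Require Import all_classical all_reals all_analysis.
From mathcomp Require Import measurable_realfun complex ring lra.

Import Order.TTheory GRing.Theory Num.Theory.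
Import numFieldNormedType.Exports.

Local Open Scope classical_set_scope.
Local Open Scope ring_scope.
Local Open Scope complex_scope.

Set Implicit Arguments.
Unset Strict Implicit.
Unset Printing Implicit Defensive.

(** Let [xi] be the step path with jump sizes [y_0 >= ... >= y_r > 0] at distinct
    times in the open unit interval, and let [M] be the last jump time. Before
    [M] there are at most [r] jumps, so both compensated processes reduce to the
    drift [- c t]; from [M] on, the [r] largest jumps miss exactly [y_r], and
    the processes equal [kappa y_r - c t] with [kappa = 1] for the first event
    and [kappa = r + 1] for the second. Since [a > 0] and [a + c > 0], the drift
    alone never reaches the level [a], and the events hold if and only if
    [kappa y_r >= a + c M] when [c > 0], and [kappa y_r >= a + c] when [c < 0]
    ([exceedL_step_path], [exceedE_step_path]).

    The map [x |-> x^(-alpha)] sends the jump measure to Lebesgue measure on the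
    positive half-line and reverses the order. Tuples of nonincreasing jumps
    whose last entry is at least [b] thus correspond to an ordered simplex of
    side [b^(-alpha)] and dimension [r + 1], of volume
    [b^(-(r+1) alpha) / (r+1)!] ([nu_ordered_ge_last]).

    With [e = (r+1) alpha], it remains to average [(a + c M)^(-e)] over the jump
    times and to multiply by [kappa^e / (r+1)!]; coinciding jump times form a
    null event ([ae_distinct_in01]). For [c < 0], with [M] replaced by 1, there
    is nothing to average. For [c > 0] the law [P (M <= t) = t^(r+1)] and
    Tonelli's theorem ([integral_tail], [expectation_maxU]) give the integral
    over the unit interval of [(r+1) t^r (a + c t)^(-e)], up to an integration
    by parts that is built into the choice of antiderivative. To recognise the
    hypergeometric function [F] at [- c / a], which may lie outside the unit
    disc, observe that the power series of [F] makes
    [g = x F' + (r+1) F] a solution of [(1 - x) g' = e g] near 0. The function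
    [(1 - x) g' - e g] is real analytic on the negative half-line, hence
    vanishes there by the identity theorem ([real_analytic_eq0]), so that
    [x F' + (r+1) F = (r+1) (1 - x)^(-e)] for all [x <= 0]
    ([hypergeometric_ode]). In other words [t^(r+1) F (- c t / a)] is an
    antiderivative of [(r+1) t^r (1 + c t / a)^(-e)] ([euler_integral]). *)

(** * Compensated functionals of a step path *)

Section path_functionals.
Context {R : realType} {r : nat}.
Variables (u : 'I_r.+1 -> R) (y : r.+1.-tuple R).
Hypotheses (u01 : forall i, 0 < u i < 1) (uI : injective u).
Hypotheses (y_gt0 : forall i, 0 < tnth y i)
  (y_decr : forall i k : 'I_r.+1, (i <= k)%N -> tnth y k <= tnth y i).

Let xi : cadlag R := step_path u y.
Let mass (t : R) : R := \sum_k tnth y k * (u k <= t)%R%:R.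

Lemma step_pathE t : 0 <= t <= 1 -> xi t = mass t.
Proof.
by move=> t01; apply: eq_bigr => i _; rewrite indic_clampE clamp_in.
Qed.

Lemma step_path_leftlim s : 0 <= s <= 1 ->
  lim (xi x @[x --> s^'-]) = \sum_k tnth y k * (u k < s)%R%:R.
Proof.
move=> /andP[s0 s1]; apply/cvg_lim; first exact: Rhausdorff.
apply: cvg_near_cst.
suff : \forall x \near s^'-, forall i, (u i <= clamp x) = (u i < s).
  by apply: filterS => x ux; apply: eq_bigr => i _; rewrite !indic_clampE ux.
apply: filter_forall => i; have /andP[ui0 ui1] := u01 i.
have [us|su] := ltP (u i) s; near=> x.
  rewrite /clamp le_max le_min (ltW ui1) andbT; apply/orP; right.
  by near: x; exact: nbhs_left_ge.
apply/negbTE; rewrite -ltNge /clamp gt_max ui0 gt_min; apply/orP; left.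
by apply: lt_le_trans su; near: x; exact: nbhs_left_lt.
Unshelve. all: by end_near. Qed.

Lemma jumpE s : 0 <= s <= 1 -> jump xi s = \sum_k tnth y k * (u k == s)%:R.
Proof.
move=> s01; rewrite /jump step_pathE// step_path_leftlim// -sumrB.
apply: eq_bigr => k _; rewrite -mulrBr; congr (_ * _).
by case: ltgtP => _; rewrite ?subrr ?subr0.
Qed.

Lemma sum_jumpE m (s : 'I_m -> R) : (forall i, 0 <= s i <= 1) ->
  \sum_i jump xi (s i) = \sum_k tnth y k * (\sum_i (u k == s i)%:R).
Proof.
move=> s01; rewrite (eq_bigr _ (fun i _ => jumpE (s01 i))) exchange_big/=.
by apply: eq_bigr => k _; rewrite mulr_sumr.
Qed.

Lemma hits_le1 m (s : 'I_m -> R) k : injective s ->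
  \sum_i (u k == s i)%:R <= 1 :> R.
Proof.
move=> sI; have [[i uki]|nex] := pselect (exists i, u k = s i).
  rewrite (bigD1 i)//= uki eqxx big1 ?addr0// => i' i'i.
  by case: eqP => // /sI e; rewrite e eqxx in i'i.
by rewrite big1// => i _; case: eqP => // e; case: nex; exists i.
Qed.

Lemma hits_above m (s : 'I_m -> R) t k : (forall i, s i <= t) -> t < u k ->
  \sum_i (u k == s i)%:R = 0 :> R.
Proof.
move=> st tu; rewrite big1// => i _; case: eqP => // e.
by move: (st i); rewrite -e leNgt tu.
Qed.

Lemma sum_jump_le_mass m (s : 'I_m -> R) t : t <= 1 ->
  (forall i, 0 <= s i <= t) -> injective s -> \sum_i jump xi (s i) <= mass t.
Proof.
move=> t1 st sI; rewrite sum_jumpE; last first.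
  by move=> i; have /andP[-> /le_trans->] := st i.
apply: ler_sum => k _; apply: ler_wpM2l; first exact/ltW.
have [ukt|tuk] := leP (u k) t; first exact: hits_le1.
by rewrite (@hits_above _ _ t)// => i; have /andP[] := st i.
Qed.

(** Each place is occupied by at most one of the [r + 1] jumps, and there are
    only [r] places, so at least one jump is missed. *)
Lemma sum_jump_le_but_last (s : 'I_r -> R) t : t <= 1 ->
  (forall i, 0 <= s i <= t) -> injective s ->
  \sum_i jump xi (s i) <= \sum_k tnth y k - tnth y ord_max.
Proof.
move=> t1 st sI; rewrite sum_jumpE; last first.
  by move=> i; have /andP[-> /le_trans->] := st i.
rewrite lerBrDr -lerBrDl -sumrB.
under eq_bigr do rewrite -{1}[tnth y _]mulr1 -mulrBr.
pose h (k : 'I_r.+1) : R := 1 - \sum_i (u k == s i)%:R.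
have h0 k : 0 <= h k by rewrite subr_ge0 hits_le1.
have h1 : 1 <= \sum_k h k.
  rewrite sumrB big_const_ord iter_addr_0 lerBrDr -lerBrDl exchange_big/=.
  have -> : 1 *+ r.+1 - 1 = \sum_(i < r) 1 :> R.
    by rewrite big_const_ord iter_addr_0 mulrS addrAC subrr add0r.
  apply: ler_sum => i _.
  have [[k ->]|nex] := pselect (exists k, s i = u k).
    rewrite (bigD1 k)//= eqxx big1 ?addr0// => k' k'k.
    by case: eqP => // /uI e; rewrite e eqxx in k'k.
  by rewrite big1// => k _; case: eqP => // e; case: nex; exists k.
apply: (@le_trans _ _ (\sum_k tnth y ord_max * h k)).
  by rewrite -mulr_sumr ler_peMr// ltW.
by apply: ler_sum => k _; apply: ler_wpM2r => //; apply: y_decr; exact: leq_ord.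
Qed.

(** Jump times in the definition of the largest jumps have to be distinct, so
    places that cannot be filled by a jump before time [t] are filled by
    distinct points below all the jump times. *)
Let delta (t : R) : R := \big[Num.min/t]_i u i.
Let place (t : R) (k : 'I_r.+1) : R := if u k <= t then u k else delta t * u k.

Let delta_gt0 t : 0 < t -> 0 < delta t.
Proof. by move=> t0; apply: lt_bigmin => // i _; have /andP[] := u01 i. Qed.

Let place_lt t k i : 0 < t -> delta t * u i < u k.
Proof.
move=> t0; apply: (@lt_le_trans _ _ (delta t)); last exact: bigmin_le.
by rewrite gtr_pMr ?delta_gt0//; have /andP[] := u01 i.
Qed.

Let place_in t k : 0 < t -> 0 <= place t k <= t.
Proof.
move=> t0; rewrite /place; have /andP[uk0 uk1] := u01 k.
case: ifPn => [->|_]; first by rewrite ltW.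
rewrite mulr_ge0 ?(ltW (delta_gt0 t0)) ?(ltW uk0)//=.
apply: (@le_trans _ _ (delta t)); last exact: bigmin_le_id.
by rewrite ger_pMr ?delta_gt0// ltW.
Qed.

Let place_inj t : 0 < t -> injective (place t).
Proof.
move=> t0 k i; rewrite /place; case: ifPn => _; case: ifPn => _.
- exact: uI.
- by move=> e; have := place_lt k i t0; rewrite e ltxx.
- by move=> e; have := place_lt i k t0; rewrite e ltxx.
- by move/(mulfI (lt0r_neq0 (delta_gt0 t0)))/uI.
Qed.

Let jump_place t k : 0 < t <= 1 ->
  jump xi (place t k) = tnth y k * (u k <= t)%R%:R.
Proof.
move=> /andP[t0 t1]; rewrite jumpE; last first.
  by have /andP[-> /le_trans->] := place_in k t0.
rewrite (bigD1 k)//= big1 ?addr0 => [|i ik].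
  rewrite /place; case: ifPn => _; first by rewrite eqxx.
  by rewrite eq_sym lt_eqF// place_lt.
rewrite /place; case: ifPn => _.
  by case: eqP => [/uI e|]; rewrite ?mulr0//; rewrite e eqxx in ik.
by rewrite eq_sym lt_eqF ?mulr0// place_lt.
Qed.

Let sup_max (A : set R) v : A v -> ubound A v -> sup A = v.
Proof.
move=> Av uv; apply/eqP; rewrite eq_le; apply/andP; split.
  by apply: ge_sup => //; exists v.
by apply: ub_le_sup => //; exists v.
Qed.

(** There is one place for every jump. *)
Lemma top_jumps_all t : 0 <= t <= 1 -> top_jumps r.+1 xi t = xi t.
Proof.
move=> t01; rewrite step_pathE// /top_jumps; have /andP[t0 t1] := t01.
case: eqP => [->|/eqP t0'].
  rewrite /mass big1// => k _; have /andP[uk0 _] := u01 k.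
  by rewrite leNgt uk0 mulr0.
have {}t0 : 0 < t by rewrite lt_neqAle eq_sym t0'.
apply: sup_max => [|_ [s [st sI] <-]]; last exact: sum_jump_le_mass.
exists (place t).
  by split; [move=> i; exact: place_in|exact: place_inj].
by apply: eq_bigr => k _; rewrite jump_place// t0.
Qed.

(** A jump later than [t] needs no place, so [r] places suffice. *)
Lemma top_jumps_early t k0 : 0 <= t <= 1 -> t < u k0 -> top_jumps r xi t = xi t.
Proof.
move=> t01 tu; rewrite step_pathE// /top_jumps; have /andP[t0 t1] := t01.
case: eqP => [->|/eqP t0'].
  rewrite /mass big1// => k _; have /andP[uk0 _] := u01 k.
  by rewrite leNgt uk0 mulr0.
have {}t0 : 0 < t by rewrite lt_neqAle eq_sym t0'.
apply: sup_max => [|_ [s [st sI] <-]]; last exact: sum_jump_le_mass.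
exists (fun i => place t (lift k0 i)).
  split; first by move=> i; exact: place_in.
  by move=> i j /(place_inj t0); exact: lift_inj.
rewrite /mass (bigD1_ord k0)//= leNgt tu mulr0 add0r.
by apply: eq_bigr => k _; rewrite jump_place// t0.
Qed.

(** The bound of [sum_jump_le_but_last] is attained at the times of the [r]
    largest jumps. *)
Lemma top_jumps_late t : 0 < t <= 1 -> (forall k, u k <= t) ->
  top_jumps r xi t = xi t - tnth y ord_max.
Proof.
move=> /andP[t0 t1] ut.
have massE : mass t = \sum_k tnth y k.
  by apply: eq_bigr => k _; rewrite ut mulr1.
rewrite step_pathE ?(ltW t0)// massE /top_jumps gt_eqF//.
apply: sup_max => [|_ [s [st sI] <-]]; last exact: sum_jump_le_but_last st _.
exists (fun i => u (lift ord_max i)).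
  split; first by move=> i; rewrite ut andbT; have /andP[/ltW] := u01 (lift ord_max i).
  by move=> i j /uI; exact: lift_inj.
rewrite [in RHS](bigD1_ord ord_max)//= addrAC subrr add0r.
apply: eq_bigr => i _; set k := lift _ _.
have := @jump_place t k; rewrite /place ut t0 t1 mulr1; exact.
Qed.

Let lastu := \big[Num.max/0]_i u i.

(** After the last jump time the supremum is reached immediately if [c > 0] and
    at time 1 if [c < 0]; before it, the drift is at most [Num.max 0 (- c)],
    which is less than [a]. *)
Lemma drifted_sup_ge (f : R -> R) (a c kappa : R) : 0 < a -> 0 < a + c -> c != 0 ->
  (forall t, 0 <= t <= 1 ->
    f t = (if lastu <= t then kappa else 0) - c * t) ->
  (a <= sup [set f t | t in `[0, 1]]) =
  (a + c * (if 0 < c then lastu else 1) <= kappa).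
Proof.
move=> a0 ac0 c0 fE.
have l0 : 0 <= lastu by exact: bigmax_ge_id.
have l1 : lastu < 1 by apply: bigmax_lt => // i _; have /andP[] := u01 i.
pose p := if 0 < c then lastu else 1.
have p01 : 0 <= p <= 1.
  by rewrite /p; case: ifP => _; rewrite ?l0 ?(ltW l1) ?lexx ?ler01.
have lp : lastu <= p by rewrite /p; case: ifP => _ //; exact: ltW.
have fp : f p = kappa - c * p by rewrite fE// lp.
have ub t : 0 <= t <= 1 -> f t <= Num.max (kappa - c * p) (Num.max 0 (- c)).
  move=> t01; have /andP[t0 t1] := t01; rewrite fE// !le_max.
  have [lt|_] := leP lastu t.
    apply/orP; left; rewrite lerD2l lerN2 /p.
    case: ltP => [cp|cn]; first by rewrite ler_pM2l.
    by rewrite ler_wnM2l.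
  apply/orP; right; rewrite sub0r; apply/orP.
  have [cp|cn] := ltP 0 c; [left|right].
    by rewrite oppr_le0 mulr_ge0// ltW.
  by rewrite lerN2 -[leLHS]mulr1 ler_wnM2l.
have hub : has_ubound [set f t | t in `[0, 1]].
  exists (Num.max (kappa - c * p) (Num.max 0 (- c))) => _ [t + <-].
  by rewrite /= in_itv/=; exact: ub.
rewrite -/p; apply/idP/idP => [|h].
  apply: contraTT; rewrite -!ltNge => h.
  apply: (@le_lt_trans _ _ (Num.max (kappa - c * p) (Num.max 0 (- c)))).
    apply: ge_sup; first by exists (f 0), 0 => //=; rewrite in_itv/= lexx ler01.
    by move=> _ [t + <-]; rewrite /= in_itv/=; exact: ub.
  rewrite !gt_max a0 ltrBlDr h/=; lra.
apply: (@le_trans _ _ (f p)); first by rewrite fp lerBrDr.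
by apply: ub_le_sup => //; exists p => //=; rewrite in_itv.
Qed.

Let lastu_le t : 0 <= t -> reflect (forall k, u k <= t) (lastu <= t).
Proof.
move=> t0; apply: (iffP idP) => [h k|h]; last exact: bigmax_le.
by apply: le_trans h; exact: le_bigmax.
Qed.

Let lastu_gt t : 0 <= t -> ~~ (lastu <= t) -> exists k, t < u k.
Proof.
move=> t0 nle; apply: contrapT => h; move/negP: nle; apply.
by apply/(lastu_le t0) => k; rewrite leNgt; apply/negP => tk; apply: h; exists k.
Qed.

Let lastu_gt0 t : lastu <= t -> 0 < t.
Proof.
move=> lt; have /andP[u0 _] := u01 ord0; apply: lt_le_trans u0 _.
by apply: le_trans lt; exact: le_bigmax.
Qed.

Lemma exceedL_step_path (a c : R) : 0 < a -> 0 < a + c -> c != 0 ->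
  exceedL r c a xi <->
  a + c * (if 0 < c then lastu else 1) <= tnth y ord_max.
Proof.
move=> a0 ac0 c0; rewrite /exceedL/=.
rewrite (@drifted_sup_ge _ a c (tnth y ord_max))// => t t01.
have /andP[t0 t1] := t01; rewrite -[step_fun u y t]/(xi t).
case: ifPn => [lt|/(lastu_gt t0)[k tk]].
  by rewrite top_jumps_late ?t1 ?(lastu_gt0 lt)//; [ring|exact/lastu_le].
by rewrite (top_jumps_early t01 tk); ring.
Qed.

Lemma exceedE_step_path (a c : R) : 0 < a -> 0 < a + c -> c != 0 ->
  exceedE r c a xi <->
  (a + c * (if 0 < c then lastu else 1)) / r.+1%:R <= tnth y ord_max.
Proof.
move=> a0 ac0 c0; rewrite ler_pdivrMr ?ltr0Sn// [tnth y _ * _]mulrC /exceedE/=.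
rewrite (@drifted_sup_ge _ a c (r.+1%:R * tnth y ord_max))// => t t01.
have /andP[t0 t1] := t01; rewrite -[step_fun u y t]/(xi t) top_jumps_all//.
have -> : r.+1%:R = r%:R + 1 :> R by rewrite natr1.
case: ifPn => [lt|/(lastu_gt t0)[k tk]].
  by rewrite top_jumps_late ?t1 ?(lastu_gt0 lt)//; [ring|exact/lastu_le].
by rewrite (top_jumps_early t01 tk); ring.
Qed.

End path_functionals.

(** * Integrals without measurability, and integration of tails *)

Section integration.
Context {R : realType}.
Local Notation leb := (@lebesgue_measure R).

(** The integral of a nonnegative function is a supremum over simple functions
    below it, so that no measurability is needed to compare. *)
Lemma ge0_integral_le d (T : measurableType d)
    (mu : {measure set T -> \bar R}) (f g : T -> \bar R) :
  (forall x, 0 <= f x)%E -> (forall x, f x <= g x)%E ->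
  (\int[mu]_x f x <= \int[mu]_x g x)%E.
Proof.
move=> f0 fg; have g0 x : (0 <= g x)%E by exact: le_trans (f0 x) (fg x).
rewrite !ge0_integralTE//; apply: ereal_sup_le => _ [h hf <-].
by exists h => // x; exact: le_trans (hf x) (fg x).
Qed.

(** Values on a null set do not count, even if they make [f] nonmeasurable:
    [f] lies between [g] set to 0 on [N] and [g] set to [+oo] on [N]. *)
Lemma ge0_integral_off_null d (T : measurableType d)
    (mu : {measure set T -> \bar R}) (N : set T) (f g : T -> \bar R) :
  measurable N -> mu N = 0%E -> (forall x, 0 <= f x)%E ->
  (forall x, ~ N x -> 0 <= g x)%E -> measurable_fun (~` N) g ->
  (forall x, ~ N x -> f x = g x) ->
  (\int[mu]_x f x = \int[mu]_(x in ~` N) g x)%E.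
Proof.
move=> mN N0 f0 g0 mg fg; apply/eqP; rewrite eq_le; apply/andP; split.
  have mgN : measurable_fun setT (g \_ (~` N)).
    by apply/(measurable_restrictT _ _).1 => //; exact: measurableC.
  have mN' : measurable_fun setT ((cst +oo%E : T -> \bar R) \_ N).
    by apply/(measurable_restrictT _ _).1.
  have gN0 x : (0 <= (g \_ (~` N)) x)%E by apply: erestrict_ge0 => y; exact: g0.
  have N0' x : (0 <= ((cst +oo%E : T -> \bar R) \_ N) x)%E.
    by apply: erestrict_ge0 => y _; exact: leey.
  apply: (@le_trans _ _ (\int[mu]_x ((g \_ (~` N)) x + (cst +oo%E \_ N) x))%E).
    apply: ge0_integral_le => // x; rewrite !patchE in_setC.
    have [xN|xN] /= := boolP (x \in N); first by rewrite add0e leey.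
    by rewrite adde0 fg//; move: xN; rewrite notin_setE.
  rewrite ge0_integralD// -!integral_mkcond integral_cst// N0 mule0 adde0.
  exact: lexx.
rewrite integral_mkcond; apply: ge0_integral_le => x.
  by apply: erestrict_ge0 => y; exact: g0.
rewrite patchE; case: ifPn => [|_]; last exact: f0.
by rewrite inE => xN; rewrite fg.
Qed.

Lemma integral_is_derive (F f : R -> R) (p q : R) : p <= q ->
  (forall t : R, p <= t <= q -> is_derive t 1 F (f t)) ->
  {within `[p, q], continuous f} ->
  (\int[leb]_(t in `[p, q]) (f t)%:E = (F q - F p)%:E)%E.
Proof.
rewrite le_eqVlt => /predU1P[-> _ _|pq dF cf].
  by rewrite set_itv1 integral_set1 subrr.
have dF' t : p <= t <= q -> derivable F t 1 by move=> /dF[].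
have cF : {within `[p, q], continuous F}.
  by apply: derivable_within_continuous => t; rewrite in_itv/= => /dF'.
rewrite (@continuous_FTC2 _ f F) ?EFinB//.
  have /(continuous_within_itvP _ pq)[_ ? ?] := cF; split => //.
  by move=> t; rewrite in_itv/= => /andP[pt tq]; apply: dF'; rewrite !ltW.
move=> t; rewrite in_itv/= => /andP[pt tq].
by rewrite derive1E; apply/derive_val/dF; rewrite !ltW.
Qed.

Lemma is_derive_mulr (f : R -> R) (t df c : R) :
  is_derive t 1 f df -> is_derive t 1 (fun x => f x * c) (df * c).
Proof.
move=> D; rewrite (_ : (fun x => f x * c) = c \*: f).
  by rewrite mulrC; exact: is_deriveZ.
by apply/funext => x; exact: mulrC.
Qed.

Lemma is_derive_exprn (f : R -> R) n (t df : R) :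
  is_derive t 1 f df -> is_derive t 1 (fun x => f x ^+ n) (n%:R * f t ^+ n.-1 * df).
Proof. by move=> D; have := is_deriveX n D; rewrite exprfctE. Qed.

Lemma is_derive_subX (sigma : R) n (t : R) :
  is_derive t 1 (fun t => (sigma - t) ^+ n) (- (n%:R * (sigma - t) ^+ n.-1)).
Proof.
have D : is_derive t (1 : R) (fun t => sigma - t) (-1).
  by rewrite -[X in is_derive _ _ _ X]add0r; apply: is_deriveB.
by have := is_derive_exprn n D; rewrite mulrN1.
Qed.

Lemma within_continuous_is_derive (f df : R -> R) (p q : R) :
  (forall t : R, is_derive t 1 f (df t)) -> {within `[p, q], continuous f}.
Proof. by move=> D; apply: derivable_within_continuous => t _; have [] := D t. Qed.

(** Tonelli's theorem, once [G q - G (Y x)] is written as the integral of [g]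
    over [Y x <= t <= q]. Only the distribution function of [Y] matters. *)
Lemma integral_tail d (T : measurableType d) (mu : {measure set T -> \bar R})
    (D : set T) (Y : T -> R) (G g : R -> R) (p q : R) :
  measurable D -> (mu D < +oo)%E -> measurable_fun setT Y -> p <= q ->
  (forall x, D x -> p <= Y x <= q) ->
  (forall t : R, p <= t <= q -> is_derive t 1 G (g t)) ->
  {within `[p, q], continuous g} ->
  (forall t, p <= t <= q -> 0 <= g t) ->
  (\int[mu]_(x in D) (G q - G (Y x))%:E =
   \int[leb]_(t in `[p, q]) ((g t)%:E * mu (D `&` [set x | Y x <= t]%R)))%E.
Proof.
move=> mD Doo mY pq DY dG cg g0.
rewrite (eq_measure_integral (mfrestr mD Doo)) /=; last first.
  by move=> A mA AD; rewrite /mfrestr /mrestr setIidl.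
pose m := mfrestr mD Doo.
pose gpq := g \_ `[p, q].
have mgpq : measurable_fun setT gpq.
  apply/(measurable_restrictT _ _).1 => //.
  exact: subspace_continuous_measurable_fun.
have gpq0 t : 0 <= gpq t.
  rewrite /gpq patchE; case: ifPn => //; rewrite inE/= in_itv/=; exact: g0.
pose A := [set z : T * R | D z.1 /\ Y z.1 <= z.2].
have mA : measurable A.
  have -> : A = (D `*` setT) `&` [set z : T * R | Y z.1 <= z.2].
    by apply/seteqP; split => z; rewrite /A/= ?andbT; [move=> []|move=> [[]]].
  apply: measurable_fun_le; first exact: measurableX.
    exact/measurable_funTS/measurableT_comp.
  exact/measurable_funTS.
pose f (z : T * R) : \bar R := ((gpq z.2)%:E * (\1_A z)%:E)%E.
have f0 z : (0 <= f z)%E by rewrite /f mule_ge0// lee_fin.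
have mf : measurable_fun setT f.
  apply: emeasurable_funM; apply/measurable_EFinP; last exact: measurable_indic.
  exact: measurableT_comp mgpq _.
have inner x : (\int[leb]_t f (x, t) = ((fun y => (G q - G (Y y))%:E) \_ D) x)%E.
  rewrite patchE; case: ifPn => Dx; last first.
    rewrite integral0_eq// => t _; rewrite /f indicE memNset ?mule0// => -[/= Dx' _].
    by move: Dx; rewrite notin_setE.
  move: Dx; rewrite inE => Dx; have /andP[pY Yq] := DY _ Dx.
  have <- : (\int[leb]_(t in `[Y x, q]) (g t)%:E = (G q - G (Y x))%:E)%E.
    apply: integral_is_derive => // [t /andP[Yt tq]|].
      by apply: dG; rewrite tq (le_trans pY).
    by apply: continuous_subspaceW cg; apply: subset_itvr; rewrite bnd_simp.
  rewrite [RHS]integral_mkcond; apply: eq_integral => t _.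
  rewrite /f /gpq !patchE indicE !mem_setE !in_itv/=.
  have [Yt|tY] := leP (Y x) t.
    rewrite mem_set//= mule1 (le_trans pY Yt)/=.
    by case: ifP.
  by rewrite memNset ?mule0//= => -[_]; rewrite leNgt tY.
rewrite [LHS]integral_mkcond -(eq_integral _ _ (fun x _ => inner x)).
rewrite (@fubini_tonelli _ _ _ _ _ m leb f)//.
rewrite [RHS]integral_mkcond; apply: eq_integral => t _ /=.
have mYt : measurable (D `&` [set x | Y x <= t]).
  by apply: measurable_fun_le => //; exact: measurable_funTS.
transitivity ((gpq t)%:E * \int[m]_x (\1_(D `&` [set x | (Y x <= t)%R]) x)%:E)%E.
  rewrite -ge0_integralZl_EFin//; apply/measurable_EFinP.
  exact: measurable_indic.
rewrite integral_indic// setIT /m/= /mfrestr /mrestr setIAC setIid.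
by rewrite /gpq !patchE; case: ifP; rewrite ?mul0e.
Qed.

End integration.

(** * Volume of ordered tuples under the power tail measure *)

Section power_tail_measure.
Context {R : realType}.
Local Notation leb := (@lebesgue_measure R).
Variables (alpha : R) (nu : {measure set (measurableTypeR R) -> \bar R}).
Hypotheses (alpha_gt0 : 0 < alpha) (nuP : is_nu alpha nu).

Let phi (x : R) : R := x `^ (- alpha).
Let psi (t : R) : R := t `^ (- alpha^-1).

Let phi_gt0 x : 0 < x -> 0 < phi x.
Proof. exact: powR_gt0. Qed.

Lemma powRN_lt (b x y : R) : 0 < b -> 0 < x -> 0 < y ->
  (x `^ (- b) < y `^ (- b)) = (y < x).
Proof.
move=> b0 x0 y0; rewrite !powRN ltf_pV2 ?posrE ?powR_gt0//.
apply/idP/idP => [|yx]; last by apply: gt0_ltr_powR; rewrite // nnegrE ltW.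
rewrite !ltNge; apply: contra => xy.
by apply: ge0_ler_powR; rewrite // ?nnegrE ltW.
Qed.

Lemma powRN_le (b x y : R) : 0 < b -> 0 < x -> 0 < y ->
  (x `^ (- b) <= y `^ (- b)) = (y <= x).
Proof. by move=> b0 x0 y0; rewrite !leNgt powRN_lt. Qed.

Let psiK t : 0 < t -> phi (psi t) = t.
Proof.
by move=> t0; rewrite /phi /psi -powRrM mulrNN mulVf ?gt_eqF// powRr1 ?ltW.
Qed.

Let psi_gt0 t : 0 < t -> 0 < psi t.
Proof. exact: powR_gt0. Qed.

Let below (t : R) := [set x : R | 0 < x /\ phi x < t].
Let shell (s t : R) := [set x : R | 0 < x /\ s <= phi x <= t].

Let belowE t : 0 < t -> below t = `]psi t, +oo[%classic.
Proof.
move=> t0; apply/seteqP; split => x; rewrite /below /= in_itv/= andbT.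
  by move=> [x0]; rewrite -{1}(psiK t0) powRN_lt// psi_gt0.
move=> tx; have x0 : 0 < x by apply: lt_trans tx; exact: psi_gt0.
by split => //; rewrite -(psiK t0) powRN_lt// psi_gt0.
Qed.

Let below0 : below 0 = set0.
Proof. by apply/seteqP; split => // x [x0]; rewrite ltNge ltW// phi_gt0. Qed.

Let measurable_below t : 0 <= t -> measurable (below t).
Proof.
rewrite le_eqVlt => /predU1P[<-|t0]; first by rewrite below0.
by rewrite belowE.
Qed.

(** In the coordinate [phi x = x^(-alpha)] the measure is Lebesgue measure on
    the positive half-line. *)
Let nu_below t : 0 <= t -> nu (below t) = t%:E.
Proof.
rewrite le_eqVlt => /predU1P[<-|t0]; first by rewrite below0 measure0.
by rewrite belowE// nuP.2 ?psi_gt0// -/(phi _) psiK.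
Qed.

Let measurable_phi : measurable_fun setT phi.
Proof. exact: measurable_powR. Qed.

Let measurable_shell s t : measurable (shell s t).
Proof.
have -> : shell s t = `]0, +oo[ `&` (phi @^-1` `[s, t]).
  apply/seteqP; split => x; rewrite /shell/= !in_itv/= andbT; first by case.
  by case.
apply: measurableI => //; rewrite -[X in measurable X]setTI.
exact: measurable_phi.
Qed.

Let nu_shell0 t : 0 <= t -> nu (shell 0 t) = t%:E.
Proof.
move=> t0; apply/eqP; rewrite eq_le; apply/andP; split.
  apply/lee_addgt0Pr => e e0; rewrite -EFinD -nu_below ?addr_ge0 ?(ltW e0)//.
  apply: le_measure; rewrite ?inE.
  - exact: measurable_shell.
  - by apply: measurable_below; rewrite addr_ge0 ?(ltW e0).
  - move=> x [x0 /andP[_ xt]]; split => //; apply: le_lt_trans xt _.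
    by rewrite ltrDl.
rewrite -[leLHS]nu_below//; apply: le_measure; rewrite ?inE.
- exact: measurable_below.
- exact: measurable_shell.
- by move=> x [x0 xt]; split => //; rewrite !ltW// phi_gt0.
Qed.

Lemma nu_shell s t : 0 <= s <= t -> nu (shell s t) = (t - s)%:E.
Proof.
move=> /andP[s0 st]; have t0 := le_trans s0 st.
have -> : shell s t = shell 0 t `\` below s.
  apply/seteqP; split => x.
    by move=> [x0 /andP[sx xt]]; split; [split => //; rewrite xt ltW// phi_gt0|
      move=> [_]; rewrite ltNge sx].
  move=> [[x0 /andP[_ xt]] nb]; split => //; rewrite xt andbT leNgt.
  by apply/negP => xs; apply: nb.
have -> : nu (shell 0 t `\` below s) =
    (nu (shell 0 t) - nu (shell 0 t `&` below s))%E.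
  apply: measureD; first exact: measurable_shell.
    exact: measurable_below.
  by rewrite -[X in (X < _)%E]/(nu (shell 0 t)) nu_shell0// ltry.
have -> : shell 0 t `&` below s = below s.
  apply/setIidPr => x [x0 xs]; split => //.
  by rewrite ltW ?phi_gt0//= ltW// (lt_le_trans xs).
by rewrite nu_shell0// nu_below.
Qed.

(** In the coordinates [phi x_i], which increase when the [x_i] decrease, this
    is an ordered simplex of side [sigma - s]. *)
Let simplex (k : nat) (s sigma : R) : set (k.-tuple R) :=
  [set y | (forall i, shell s sigma (tnth y i)) /\
           (forall i j : 'I_k, (i <= j)%N -> tnth y j <= tnth y i)].

Lemma product_power_set0 k : product_power nu (@set0 (k.-tuple R)) = 0%E.
Proof.
elim: k => [|k IH] /=; first by rewrite /dirac indicE in_set0.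
by apply: integral0_eq => x _; rewrite -[RHS]IH; congr (product_power _ _).
Qed.

Lemma product_power_ge0 k (B : set (k.-tuple R)) : (0 <= product_power nu B)%E.
Proof.
elim: k B => [|k IH] B /=; first by rewrite /dirac lee_fin.
by apply: integral_ge0 => x _.
Qed.

Let simplex_cons (k : nat) (s sigma x : R) :
  [set y : k.-tuple R | @simplex k.+1 s sigma [tuple of x :: y]] =
  (if x \in shell s sigma then @simplex k (phi x) sigma else set0).
Proof.
case: ifPn => [|/negP]; rewrite inE => xs; apply/seteqP; split => //= y.
- move=> [ys yd]; have [x0 /andP[sx xsigma]] := xs; split => [i|i j ij].
    have := ys (lift ord0 i); rewrite tnthS => -[yi0 /andP[_ yis]].
    split => //; rewrite yis andbT powRN_le//.
    by have := yd ord0 (lift ord0 i); rewrite tnthS tnth0; exact.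
  by have := yd (lift ord0 i) (lift ord0 j); rewrite !tnthS; apply.
- move=> [ys yd]; have [x0 /andP[sx xsigma]] := xs; split => [i|i j ij].
    case: (unliftP ord0 i) => [i' ->|->]; last by rewrite tnth0.
    rewrite tnthS; have [yi0 /andP[xyi yis]] := ys i'.
    by split => //; rewrite yis andbT (le_trans sx).
  case: (unliftP ord0 i) (ij) => [i' ->|->]; last first.
    move=> _; rewrite tnth0; case: (unliftP ord0 j) => [j' ->|->].
      by rewrite tnthS; have [yj0 /andP[+ _]] := ys j'; rewrite powRN_le.
    by rewrite tnth0.
  case: (unliftP ord0 j) => [j' ->|->]; last by rewrite lift0.
  by rewrite !tnthS !lift0 ltnS => /yd.
- by move=> [/(_ ord0) + _]; rewrite tnth0 => /xs.
Qed.

Let is_derive_simplexX k (sigma t : R) :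
  is_derive t 1 (fun t => (sigma - t) ^+ k.+1 / k.+1`!%:R)
    (- ((sigma - t) ^+ k / k`!%:R)).
Proof.
have := @is_derive_mulr _ _ _ _ (k.+1`!%:R^-1 : R) (is_derive_subX sigma k.+1 t).
move/is_derive_eq; apply; rewrite /= factS natrM; field.
by rewrite nat1r !pnatr_eq0/= -lt0n fact_gt0.
Qed.

(** Integration of the volume of a face, parametrised by its smallest
    coordinate [t], against the distribution function [t - s]. *)
Let integral_beta k (s sigma : R) : s <= sigma ->
  (\int[leb]_(t in `[s, sigma]) ((sigma - t) ^+ k / k`!%:R * (t - s))%:E =
   ((sigma - s) ^+ k.+2 / k.+2`!%:R)%:E)%E.
Proof.
move=> ssigma.
pose G t := - ((sigma - t) ^+ k.+1 / k.+1`!%:R * (t - s)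
   + (sigma - t) ^+ k.+2 / k.+2`!%:R).
have Ds (t : R) : is_derive t 1 (fun t => t - s) 1.
  by rewrite -[X in is_derive _ _ _ X]subr0; apply: is_deriveB.
transitivity (G sigma - G s)%:E; last first.
  by rewrite /G !subrr !expr0n/= !mul0r addr0 oppr0 sub0r mulr0 add0r opprK.
apply: integral_is_derive => //.
- move=> t _; have D := is_deriveD
    (is_deriveM (is_derive_simplexX k sigma t) (Ds t)) (is_derive_simplexX k.+1 sigma t).
  apply: is_derive_eq (is_deriveN D) _; rewrite /GRing.scale/=; ring.
- apply: within_continuous_is_derive => t.
  have D := @is_derive_mulr _ _ _ _ (k`!%:R^-1 : R) (is_derive_subX sigma k t).
  exact: is_deriveM D (Ds t).
Qed.

(** The first entry of the tuple has the smallest coordinate, which bounds the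
    remaining ones from below. *)
Let product_power_simplex k (s sigma : R) : 0 <= s <= sigma ->
  product_power nu (@simplex k s sigma) = ((sigma - s) ^+ k / k`!%:R)%:E.
Proof.
elim: k s => [|k IH] s /andP[s0 ssigma].
  rewrite /= /dirac indicE mem_set ?expr0 ?fact0 ?divr1//.
  by split; case.
have step (x : R) : product_power nu
    [set y : k.-tuple R | @simplex k.+1 s sigma [tuple of x :: y]] =
   (((fun x => ((sigma - phi x) ^+ k / k`!%:R)%:E) \_ (shell s sigma)) x).
  rewrite simplex_cons patchE; case: ifPn => [|_]; last exact: product_power_set0.
  by rewrite inE => -[x0 /andP[sx xs]]; rewrite IH// xs ltW// phi_gt0.
transitivity (\int[nu]_(x in shell s sigma)
    ((sigma - phi x) ^+ k / k`!%:R)%:E)%E.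
  by rewrite integral_mkcond; apply: eq_integral => x _; exact: step.
(* In dimension one the integrand is the constant 1, which does not vanish at
   [phi x = sigma] and so is not of the form [G sigma - G (phi x)]. *)
case: k {IH step} => [|k].
  transitivity (\int[nu]_(x in shell s sigma) cst 1%E x)%E.
    by apply: eq_integral => x _; rewrite expr0 fact0 divr1.
  rewrite integral_cst; last exact: measurable_shell.
  by rewrite mul1e nu_shell ?s0// expr1 divr1.
pose G t : R := - ((sigma - t) ^+ k.+1 / k.+1`!%:R).
pose g t : R := (sigma - t) ^+ k / k`!%:R.
transitivity (\int[nu]_(x in shell s sigma) (G sigma - G (phi x))%:E)%E.
  apply: eq_integral => x _; congr _%:E.
  by rewrite /G subrr expr0n/= mul0r oppr0 add0r opprK.
have shellT t : s <= t <= sigma ->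
    shell s sigma `&` [set x | phi x <= t] = shell s t.
  move=> /andP[st tsigma]; apply/seteqP; split => x.
    by move=> [[x0 /andP[sx _]] xt]; split => //; rewrite sx.
  by move=> [x0 /andP[sx xt]]; split => //; split => //; rewrite sx (le_trans xt).
transitivity (\int[leb]_(t in `[s, sigma])
    ((g t)%:E * nu (shell s sigma `&` [set x | phi x <= t]%R)))%E; last first.
  rewrite -integral_beta//; apply: eq_integral => t; rewrite inE/= in_itv/= => st.
  by rewrite shellT// nu_shell ?EFinM// s0; have /andP[] := st.
apply: integral_tail.
- exact: measurable_shell.
- by rewrite nu_shell ?s0// ltry.
- exact: measurable_phi.
- by [].
- by move=> x [].
- move=> t _; have := is_deriveN (is_derive_simplexX k sigma t).
  by rewrite opprK.
- apply: within_continuous_is_derive => t.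
  exact: @is_derive_mulr _ _ _ _ (k`!%:R^-1 : R) (is_derive_subX sigma k t).
- by move=> t /andP[_ ts]; rewrite divr_ge0// exprn_ge0// subr_ge0.
Qed.

(** The last entry is the smallest, so all the coordinates [phi x_i] are at most
    [b^(-alpha)], and the tuples fill an ordered simplex of that side. *)
Lemma nu_ordered_ge_last k (b : R) (B : set (k.+1.-tuple R)) : 0 < b ->
  (forall y, ordered_orthant y -> B y <-> b <= tnth y ord_max) ->
  nu_ordered nu B = (b `^ (- (k.+1%:R * alpha)) / k.+1`!%:R)%:E.
Proof.
move=> b0 BP; have -> : b `^ (- (k.+1%:R * alpha)) = (phi b - 0) ^+ k.+1.
  by rewrite subr0 /phi -powR_mulrn ?powR_ge0// -powRrM mulNr mulrC.
rewrite -product_power_simplex ?lexx ?ltW ?phi_gt0//; congr product_power.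
apply/seteqP; split => y.
  move=> [By yo]; split; last exact: yo.2.
  move=> i; have yi0 := yo.1 i; split => //.
  rewrite ltW ?phi_gt0//= powRN_le//; move/BP : By => /(_ yo) /le_trans; apply.
  by apply: yo.2; exact: leq_ord.
move=> [ys yd]; have yo : ordered_orthant y by split => // i; have [] := ys i.
split => //; apply/BP => //; have [y0 /andP[_]] := ys ord_max.
by rewrite powRN_le.
Qed.

End power_tail_measure.

(** * The largest of independent uniform variables *)

Section iid_uniforms.
Context {R : realType} d (T : measurableType d) (P : probability T R).
Context (n : nat) (U : 'I_n -> {RV P >-> R}).
Hypothesis iidU : iid_uniform U.
Local Notation leb := (@lebesgue_measure R).

Lemma uniform_prob_lebesgue (B : set R) : measurable B ->
  uniform_prob (@ltr01 R) B = leb (B `&` `[0, 1]).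
Proof.
move=> mB; rewrite /uniform_prob integral_uniform_pdf.
transitivity (\int[leb]_(x in B `&` `[0%R, 1%R]) cst 1%E x)%E.
  apply: eq_integral => x; rewrite inE/= in_itv/= => -[_ x01].
  by rewrite /uniform_pdf x01 subr0 invr1.
by rewrite integral_cst ?mul1e//; exact: measurableI.
Qed.

Let lawU i (B : set R) : measurable B -> P (U i @^-1` B) = leb (B `&` `[0, 1]).
Proof.
by move=> mB; have [law _] := iidU; rewrite -uniform_prob_lebesgue// -(law i).
Qed.

Let indepU (B : 'I_n -> set R) : (forall i, measurable (B i)) ->
  P (\bigcap_i (U i @^-1` B i)) = (\prod_(i < n) P (U i @^-1` B i))%E.
Proof. by have [_] := iidU; exact. Qed.

Let law_le i t : 0 <= t <= 1 -> P (U i @^-1` `]-oo, t]) = t%:E.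
Proof.
move=> /andP[t0 t1]; rewrite lawU//.
have -> : `]-oo, t] `&` `[0, 1] = `[0, t]%classic.
  apply/seteqP; split => x; rewrite /= !in_itv/=; first by move=> [-> /andP[->]].
  by move=> /andP[-> xt]; rewrite xt (le_trans xt).
rewrite lebesgue_measure_itv/= lte_fin; case: ltP => [_|t0'].
  by rewrite oppr0 adde0.
by congr _%:E; apply/eqP; rewrite eq_le t0 t0'.
Qed.

Let measurable_preU i (B : set R) : measurable B -> measurable (U i @^-1` B).
Proof. by move=> mB; rewrite -[X in measurable X]setTI; exact: measurable_funP. Qed.

Let ae_U01 i : {ae P, forall w, 0 < U i w < 1}.
Proof.
exists (U i @^-1` (~` `]0, 1[)); split.
- by apply: measurable_preU; exact: measurableC.
- rewrite lawU; last exact: measurableC.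
  have -> : ~` `]0, 1[ `&` `[0, 1] = [set 0] `|` [set 1 : R].
    apply/seteqP; split => x /=; rewrite !in_itv/=.
      move=> [/negP + /andP[x0 x1]]; rewrite negb_and -!leNgt => /orP[x0'|x1'].
        by left; apply/eqP; rewrite eq_le x0'.
      by right; apply/eqP; rewrite eq_le x1 x1'.
    by case=> ->; rewrite ltxx ?lexx ?ler01 ?andbF/=.
  rewrite -(lebesgue_measure_set1 (0 : R)); apply: measureU0 => //.
  exact: lebesgue_measure_set1.
- by move=> w /= /negP; rewrite in_itv/= => /negP.
Qed.

Let cell (m l : nat) : set R := `[l%:R / m.+1%:R, l.+1%:R / m.+1%:R]%classic.

Let lebesgue_cell m l : (leb (cell m l `&` `[0%R, 1%R]) <= (m.+1%:R^-1)%:E)%E.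
Proof.
apply: (@le_trans _ _ (leb (cell m l))).
  have mcell : measurable (cell m l) by exact: measurable_itv.
  by apply: le_measure; rewrite ?inE//; exact: measurableI.
rewrite lebesgue_measure_itv/= lte_fin; case: ifP => _; last by rewrite lee_fin.
by rewrite -EFinB -mulrBl -natrB// subSnn mul1r.
Qed.

(** Two independent uniform variables agree only if they fall into the same
    cell of each regular subdivision of the unit interval, which for [m+1]
    cells has probability at most [1/(m+1)]. *)
Let ae_neq i k : i != k -> {ae P, forall w, U i w != U k w}.
Proof.
move=> ik; pose E := [set w | U i w = U k w] `&` (U i @^-1` `]0, 1[).
have mE : measurable E.
  apply: measurableI; last exact: measurable_preU.
  have -> : [set w | U i w = U k w] =
      [set w | U i w <= U k w] `&` [set w | U k w <= U i w].
    apply/seteqP; split => w /=; first by move=> ->.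
    by move=> [ik' ki]; apply/eqP; rewrite eq_le ik'.
  by apply: measurableI; rewrite -[X in measurable X]setTI;
    apply: measurable_fun_le => //; exact: measurable_funP.
pose A m l := (U i @^-1` cell m l) `&` (U k @^-1` cell m l).
have mA m l : measurable (A m l).
  have mcell : measurable (cell m l) by exact: measurable_itv.
  by apply: measurableI; apply: measurable_preU.
have PA m l : (P (A m l) <= (m.+1%:R^-1 * m.+1%:R^-1)%:E)%E.
  pose B j := if (j == i) || (j == k) then cell m l else setT.
  have -> : A m l = \bigcap_j (U j @^-1` B j).
    apply/seteqP; split => w; rewrite /A /B /=.
      by move=> [wi wk] j _ /=; case: ifPn => // /orP[/eqP->|/eqP->].
    by move=> h; split; [have := h i|have := h k]; rewrite eqxx ?orbT; exact.
  rewrite indepU => [|j]; last first.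
    by rewrite /B; case: ifP => _; [exact: measurable_itv|exact: measurableT].
  rewrite (bigD1 i)//= (bigD1 k)/=; last by rewrite eq_sym.
  rewrite big1 ?mule1 => [|j /andP[ji jk]]; last first.
    by rewrite /B (negbTE ji) (negbTE jk) preimage_setT probability_setT.
  rewrite /B !eqxx orbT EFinM; apply: lee_pmul => //;
    by rewrite lawU; [exact: lebesgue_cell|exact: measurable_itv].
have PE m : (P E <= (m.+1%:R^-1)%:E)%E.
  apply: (@le_trans _ _ (P (\big[setU/set0]_(l < m.+1) A m l))).
    apply: le_measure; rewrite ?inE//; first exact: bigsetU_measurable.
    move=> w [/= Uik]; rewrite in_itv/= => /andP[x0 x1].
    have /andP[lx xl] := truncn_itv (mulr_ge0 (ltW x0) (ler0n _ m.+1)).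
    set l := Num.truncn _ in lx xl.
    have lm : (l < m.+1)%N.
      by rewrite -(ltr_nat R) (le_lt_trans lx)// gtr_pMl.
    rewrite -bigcup_mkord; exists l => //.
    by split; rewrite /cell/= in_itv/= -?Uik ler_pdivrMr// ler_pdivlMr// lx ltW.
  apply: (@le_trans _ _ (\sum_(l < m.+1) P (A m l))%E); first exact: Boole_inequality.
  apply: (@le_trans _ _ (\sum_(l < m.+1) (m.+1%:R^-1 * m.+1%:R^-1 : R)%:E)%E).
    by apply: lee_sum => l _.
  rewrite sumEFin sumr_const card_ord -[X in (X%:E <= _)%E]mulr_natl.
  by rewrite mulrA mulfV ?mul1r// pnatr_eq0.
have PE0 : P E = 0%E.
  apply/eqP; rewrite eq_le measure_ge0 andbT; apply/lee_addgt0Pr => e e0.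
  rewrite add0e; apply: (le_trans (PE (Num.truncn e^-1))).
  rewrite lee_fin -[leRHS]invrK lef_pV2 ?posrE ?invr_gt0// ltW//.
  have e'0 : 0 <= e^-1 by rewrite invr_ge0 ltW.
  by have /andP[] := truncn_itv e'0.
have aeE : {ae P, forall w, ~ E w} by exists E; split => // w /contrapT.
have := ae_U01 i; apply: filterS2 aeE => w nE U01; apply/eqP => Uik.
by apply: nE; split => //=; rewrite in_itv.
Qed.

Lemma ae_distinct_in01 :
  {ae P, forall w, (forall i, 0 < U i w < 1) /\ injective (U ^~ w)}.
Proof.
have h1 : {ae P, forall w, forall i, 0 < U i w < 1} by apply: filter_forall.
have h2 : {ae P, forall w, forall i k, i != k -> U i w != U k w}.
  apply: filter_forall => i; apply: filter_forall => k.
  have [->|ik] := eqVneq i k; first by apply: filterE => w; rewrite eqxx.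
  by have := ae_neq ik; apply: filterS => w.
apply: filterS2 h1 h2 => w h1 h2; split => // i k Uik.
by apply/eqP/negPn/negP => /h2; rewrite Uik eqxx.
Qed.

Definition maxU (w : T) : R := \big[Num.max/0]_i U i w.

Lemma measurable_maxU : measurable_fun setT maxU.
Proof.
rewrite /maxU; elim: (index_enum _) => [|i s IH].
  by under eq_fun do rewrite big_nil; exact: measurable_cst.
under eq_fun do rewrite big_cons.
by apply: measurable_maxr; [exact: measurable_funP|exact: IH].
Qed.

Lemma maxU_law t : 0 <= t <= 1 -> P [set w | maxU w <= t] = (t ^+ n)%:E.
Proof.
move=> t01; have /andP[t0 _] := t01.
have -> : [set w | maxU w <= t] = \bigcap_i (U i @^-1` `]-oo, t]).
  apply/seteqP; split => w /=.
    move=> h i _ /=; rewrite in_itv/=; apply: le_trans h; exact: le_bigmax.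
  by move=> h; apply: bigmax_le => // i _; have := h i; rewrite /= in_itv/=; exact.
rewrite indepU// (eq_bigr (fun=> t%:E)) => [|i _]; last exact: law_le.
by rewrite prodEFin prodr_const card_ord.
Qed.

(** Write [h (maxU w)] as [h 1] plus the integral of [g = - h'] from [maxU w]
    to 1, and integrate in [w] first. *)
Lemma expectation_maxU (N : set T) (h g : R -> R) :
  measurable N -> P N = 0%E -> (forall w, ~ N w -> maxU w <= 1) ->
  (forall t : R, 0 <= t <= 1 -> is_derive t 1 h (- g t)) ->
  {within `[0, 1], continuous g} -> (forall t, 0 <= t <= 1 -> 0 <= g t) ->
  0 <= h 1 ->
  (\int[P]_(w in ~` N) (h (maxU w))%:E =
   (h 1)%:E + \int[leb]_(t in `[0%R, 1%R]) (g t * t ^+ n)%:E)%E.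
Proof.
move=> mN N0 M1 dh cg g0 h1.
have mNC : measurable (~` N) by exact: measurableC.
have PNC : P (~` N) = 1%E.
  by rewrite probability_setC// N0 sube0.
have M01 w : (~` N) w -> 0 <= maxU w <= 1.
  by move=> /M1 ->; rewrite andbT; exact: bigmax_ge_id.
have hE : (\int[P]_(w in ~` N) (h (maxU w) - h 1)%:E =
    \int[leb]_(t in `[0%R, 1%R])
      ((g t)%:E * P (~` N `&` [set w | maxU w <= t]%R)))%E.
  transitivity (\int[P]_(w in ~` N) (((- h) 1 - (- h) (maxU w))%R)%:E)%E.
    by apply: eq_integral => w _; rewrite /= opprK addrC.
  apply: integral_tail => //.
  - by rewrite -[X in (X < _)%E]/(P (~` N)) PNC ltry.
  - exact: measurable_maxU.
  - by move=> t t01; rewrite -[g t]opprK; apply: is_deriveN; exact: dh.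
have PMN t : 0 <= t <= 1 -> P (~` N `&` [set w | maxU w <= t]) = (t ^+ n)%:E.
  move=> t01; rewrite -maxU_law// setIC -setDE.
  set B := [set w | maxU w <= t]; have mB : measurable B.
    rewrite -[X in measurable X]setTI; apply: measurable_fun_le => //.
    exact: measurable_maxU.
  have -> : P (B `\` N) = (P B - P (B `&` N))%E.
    by apply: measureD => //; exact: (le_lt_trans (probability_le1 P mB) (ltry _)).
  rewrite [X in (_ - X)%E](_ : _ = 0%E) ?sube0//.
  by apply: subset_measure0 N0 => //; exact: measurableI.
have h1M w : (~` N) w -> h 1 <= h (maxU w).
  move=> /M01/andP[M0 M1'].
  have : (0 <= ((- h) 1 - (- h) (maxU w))%:E)%E.
    have <- : (\int[leb]_(t in `[maxU w, 1%R]) (g t)%:E =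
        ((- h) 1 - (- h) (maxU w))%:E)%E.
      apply: integral_is_derive => // [t /andP[Mt t1]|].
        rewrite -[g t]opprK; apply: is_deriveN; apply: dh.
        by rewrite t1 (le_trans M0).
      by apply: continuous_subspaceW cg; apply: subset_itvr; rewrite bnd_simp.
    apply: integral_ge0 => t /=; rewrite in_itv/= lee_fin => /andP[Mt t1].
    by apply: g0; rewrite t1 (le_trans M0).
  by rewrite lee_fin /= opprK addrC subr_ge0.
have mhM : measurable_fun (~` N) (h \o maxU).
  apply: (@measurable_comp _ _ _ T _ _ (`[0, 1]%classic : set R) h (~` N) maxU) => //.
  - by move=> _ [w /M01 + <-]; rewrite /= in_itv.
  - apply: subspace_continuous_measurable_fun => //.
    apply: derivable_within_continuous => t; rewrite in_itv/= => t01.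
    by have [] := dh t t01.
  - exact: measurable_funTS measurable_maxU.
transitivity (\int[P]_(w in ~` N) ((h (maxU w) - h 1)%:E + (h 1)%:E))%E.
  by apply: eq_integral => w _; rewrite -EFinD subrK.
rewrite ge0_integralD//; last 2 first.
- by move=> w Nw; rewrite lee_fin subr_ge0 h1M.
- by apply/measurable_EFinP; apply: measurable_funB.
rewrite integral_cst// -[X in (_ + _ * X)%E]/(P (~` N)) PNC mule1 hE addeC.
congr (_ + _)%E.
apply: eq_integral => t; rewrite inE/= in_itv/= => t01.
by rewrite PMN// EFinM.
Qed.

End iid_uniforms.

(** * Real power series and the identity theorem *)

Section real_power_series.
Context {R : realType}.
Implicit Types (a : R^nat) (f : R -> R).

(** Partial sums of the derived geometric series, in a form that bounds them by
    [(1 - q) ^- 2] for [0 <= q < 1]. *)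
Lemma geometric_diffs_sumE (q : R) n :
  (\sum_(0 <= k < n) k.+1%:R * q ^+ k) * (1 - q) ^+ 2 =
  1 - n.+1%:R * q ^+ n + n%:R * q ^+ n.+1.
Proof.
elim: n => [|n IH]; first by rewrite big_nil mul0r expr0; ring.
rewrite big_nat_recr//= mulrDl IH !exprS -!natr1; ring.
Qed.

Lemma is_cvg_geometric_diffs (q : R) : 0 <= q < 1 ->
  cvgn (series (fun k => k.+1%:R * q ^+ k)).
Proof.
move=> /andP[q0 q1]; apply: nondecreasing_is_cvgn.
  apply: nondecreasing_series => n _ _; exact: mulr_ge0 (exprn_ge0 _ _).
exists ((1 - q) ^- 2) => _ [n _ <-].
rewrite -[leRHS]mul1r ler_pdivlMr ?exprn_gt0 ?subr_gt0//.
rewrite geometric_diffs_sumE exprS -natr1.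
have : 0 <= n%:R * q ^+ n * (1 - q).
  by rewrite !mulr_ge0 ?exprn_ge0// subr_ge0 ltW.
have : 0 <= q ^+ n by exact: exprn_ge0.
nra.
Qed.

(** Comparison with the derived geometric series: the terms [a n * x ^+ n] are
    bounded. *)
Lemma is_cvg_pseries_diffs a (x z : R) :
  cvgn (pseries a x) -> `|z| < `|x| -> cvgn (pseries (pseries_diffs a) z).
Proof.
move=> ax zx; have [B [Breal aB]] := cvg_series_bounded ax.
have x0 : 0 < `|x| by exact: le_lt_trans zx.
pose K := `|B + 1|; have K0 : 0 <= K by exact: normr_ge0.
have aK n : `|a n * x ^+ n| <= K.
  by apply: aB => //; apply: lt_le_trans (ler_norm _); rewrite ltrDl.
pose q := `|z| / `|x|.
have q01 : 0 <= q < 1 by rewrite divr_ge0//= ltr_pdivrMr// mul1r.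
apply: normed_cvg.
apply: (@series_le_cvg _ _ (fun n => K / `|x| * (n.+1%:R * q ^+ n))).
- by move=> n; exact: normr_ge0.
- move=> n; have /andP[q0 _] := q01; rewrite /=.
  by apply: mulr_ge0; [exact: divr_ge0|rewrite mulr_ge0// exprn_ge0].
- move=> n /=; rewrite /pseries_diffs !normrM normrX ger0_norm//.
  have -> : K / `|x| * (n.+1%:R * q ^+ n) =
      n.+1%:R * (K / `|x| ^+ n.+1) * `|z| ^+ n.
    by rewrite /q expr_div_n exprS; field; rewrite expf_neq0 lt0r_neq0.
  apply: ler_wpM2r; first exact: exprn_ge0.
  apply: ler_wpM2l => //; rewrite ler_pdivlMr ?exprn_gt0//.
  by have := aK n.+1; rewrite normrM normrX.
- by apply: is_cvg_seriesZ; exact: is_cvg_geometric_diffs.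
Qed.

Definition pseries_sum f (x0 rho : R) a :=
  forall x, `|x - x0| < rho -> pseries a (x - x0) @ \oo --> f x.

Definition real_analytic_at f (x0 : R) :=
  exists a, exists2 rho, 0 < rho & pseries_sum f x0 rho a.

Lemma pseries_sum_cvg_diffs f x0 rho a : pseries_sum f x0 rho a ->
  forall z, `|z| < rho -> cvgn (pseries (pseries_diffs a) z).
Proof.
move=> fa z zr; have [K /andP[zK Kr]] : exists K : R, `|z| < K < rho.
  by exists ((`|z| + rho) / 2); rewrite midf_lt//= midf_lt.
have K0 : 0 < K by exact: le_lt_trans zK.
apply: (@is_cvg_pseries_diffs _ K); last by rewrite (gtr0_norm K0).
by have := fa (K + x0); rewrite addrK (gtr0_norm K0) => /(_ Kr)/cvgP.
Qed.

Lemma pseries_sum_is_derive f x0 rho a : pseries_sum f x0 rho a ->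
  forall x, `|x - x0| < rho ->
  is_derive x 1 f (limn (pseries (pseries_diffs a) (x - x0))).
Proof.
move=> fa x xr; set z := x - x0.
have [K /andP[zK Kr]] : exists K : R, `|z| < K < rho.
  by exists ((`|z| + rho) / 2); rewrite midf_lt//= midf_lt.
have [K' /andP[KK' Kr']] : exists K' : R, K < K' < rho.
  by exists ((K + rho) / 2); rewrite midf_lt//= midf_lt.
have K0 : 0 < K by exact: le_lt_trans zK.
have K'0 : 0 < K' by exact: lt_trans KK'.
have aK : cvgn (pseries a K).
  by have := fa (K + x0); rewrite addrK (gtr0_norm K0) => /(_ Kr)/cvgP.
have daK' : cvgn (pseries (pseries_diffs a) K').
  by apply: pseries_sum_cvg_diffs fa _ _; rewrite gtr0_norm.
have daK : cvgn (pseries (pseries_diffs a) K).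
  by apply: pseries_sum_cvg_diffs fa _ _; rewrite gtr0_norm.
have ddaK : cvgn (pseries (pseries_diffs (pseries_diffs a)) K).
  by apply: is_cvg_pseries_diffs daK' _; rewrite !gtr0_norm.
have zK' : `|z| < `|K| by rewrite (gtr0_norm K0).
have D := pseries_snd_diffs aK daK ddaK zK'.
have Ds : is_derive x (1 : R) (fun t => t - x0) 1.
  by rewrite -[X in is_derive _ _ _ X]subr0; apply: is_deriveB.
have := @is_derive1_comp _ (fun t => limn (pseries a t)) (fun t => t - x0) x _ _ D Ds.
rewrite mulr1; apply: near_eq_is_derive.
have : \forall t \near x, `|t - x0| < rho.
  near=> t; rewrite -(subrK x t) -addrA.
  apply: (le_lt_trans (ler_normD _ _)); rewrite -ltrBrDr distrC.
  by near: t; apply: nbhsx_ballx; rewrite subr_gt0.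
by apply: filterS => t tr /=; apply/cvg_lim => //; exact: fa.
Unshelve. all: by end_near. Qed.

Lemma real_analytic_is_derive f x0 : real_analytic_at f x0 ->
  is_derive x0 1 f (f^`()%classic x0).
Proof.
move=> [a [rho r0 fa]]; rewrite derive1E; apply: derivableP.
by have [] := pseries_sum_is_derive fa (_ : `|x0 - x0| < rho); rewrite ?subrr ?normr0.
Qed.

Lemma pseries_sum_derive f x0 rho a : pseries_sum f x0 rho a ->
  pseries_sum f^`()%classic x0 rho (pseries_diffs a).
Proof.
move=> fa x xr; rewrite derive1E.
rewrite (@derive_val _ _ _ _ _ _ _ (pseries_sum_is_derive fa xr)).
exact: pseries_sum_cvg_diffs fa _ xr.
Qed.

Definition pseries_shift a : R^nat := fun n => if n is k.+1 then a k else 0.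

Lemma pseries_sum_shift f x0 rho a : pseries_sum f x0 rho a ->
  pseries_sum (fun x => (x - x0) * f x) x0 rho (pseries_shift a).
Proof.
move=> fa x xr; rewrite -cvg_shiftS /=.
under eq_fun.
  move=> n; rewrite /pseries /series/= big_nat_recl//= mul0r add0r.
  under eq_bigr do rewrite exprS mulrCA.
  rewrite -mulr_sumr; over.
by apply: cvgMl_tmp; exact: fa.
Qed.

(** The two operators applied to the hypergeometric function are of this form.
    The coefficients are kept explicit so that, at the origin, the vanishing of
    the result can be read off from a recurrence. *)
Lemma pseries_sum_operator f x0 rho a (p q s : R) : pseries_sum f x0 rho a ->
  pseries_sum (fun x => (p + q * x) * f^`()%classic x + s * f x) x0 rho
    (fun n => (p + q * x0) * pseries_diffs a n +
       (q * pseries_shift (pseries_diffs a) n + s * a n)).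
Proof.
move=> fa x xr; have fa' := pseries_sum_derive fa.
have -> : (p + q * x) * f^`()%classic x + s * f x =
  (p + q * x0) * f^`()%classic x + (q * ((x - x0) * f^`()%classic x) + s * f x) by ring.
have -> : pseries (fun n => (p + q * x0) * pseries_diffs a n +
       (q * pseries_shift (pseries_diffs a) n + s * a n)) (x - x0) =
  (fun n => (p + q * x0) * pseries (pseries_diffs a) (x - x0) n +
   (q * pseries (pseries_shift (pseries_diffs a)) (x - x0) n +
    s * pseries a (x - x0) n)).
  apply/funext => n; rewrite /pseries /series/= !mulr_sumr -!big_split/=.
  by apply: eq_bigr => i _; ring.
apply: cvgD; first by apply: cvgMl_tmp; exact: fa'.
by apply: cvgD; apply: cvgMl_tmp; [exact: (pseries_sum_shift fa')|exact: fa].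
Qed.

Lemma real_analytic_operator f x0 (p q s : R) : real_analytic_at f x0 ->
  real_analytic_at (fun x => (p + q * x) * f^`()%classic x + s * f x) x0.
Proof.
move=> [a [rho r0 fa]]; eexists; exists rho => //.
exact: pseries_sum_operator fa.
Qed.

Lemma pseries_right0_head (rho delta : R) a : 0 < rho -> 0 < delta ->
  (forall z, `|z| < rho -> cvgn (pseries a z)) ->
  (forall z, 0 < z < delta -> limn (pseries a z) = 0) -> a 0 = 0.
Proof.
move=> r0 d0 ca a0.
have fa : pseries_sum (fun z => limn (pseries a z)) 0 rho a.
  by move=> z; rewrite subr0 => /ca.
have c0 : `|0 - 0 : R| < rho by rewrite subrr normr0.
have [df _] := pseries_sum_is_derive fa c0.
have a00 : limn (pseries a 0) = a 0.
  apply/cvg_lim => //; rewrite -cvg_shiftS /=; apply: cvg_near_cst.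
  near=> n; rewrite /pseries /series/= big_nat_recl//= expr0 mulr1.
  by rewrite big1 ?addr0// => i _; rewrite expr0n mulr0.
have /differentiable_continuous/cvg_at_right_filter :
  differentiable (fun z => limn (pseries a z)) 0.
  exact/derivable1_diffP.
rewrite a00 => l1.
have l2 : limn (pseries a z) @[z --> 0^'+] --> (0 : R).
  apply: cvg_near_cst; near=> z; apply: a0; apply/andP; split.
    by near: z; exact: nbhs_right_gt.
  by near: z; exact: nbhs_right_lt.
exact: (cvg_unique (@Rhausdorff R) l1 l2).
Unshelve. all: by end_near. Qed.

(** The constant term vanishes because the sum is continuous at the centre; the
    series can then be divided by the variable. *)
Lemma pseries_right0 (rho delta : R) a : 0 < rho -> 0 < delta ->
  (forall z, `|z| < rho -> cvgn (pseries a z)) ->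
  (forall z, 0 < z < delta -> limn (pseries a z) = 0) -> forall n, a n = 0.
Proof.
wlog dr : delta / delta <= rho => [wl r0 d0 ca az|].
  apply: (wl (Num.min delta rho)) => //; first by rewrite ge_min lexx orbT.
    by rewrite lt_min d0.
  by move=> z /andP[z0]; rewrite lt_min => /andP[zd _]; apply: az; rewrite z0.
move=> r0 d0 + + n; elim: n a => [|n IH] a ca az.
  exact: pseries_right0_head r0 d0 ca az.
have a0 := pseries_right0_head r0 d0 ca az.
pose b k := a k.+1.
have bz z k : z * pseries b z k = pseries a z k.+1.
  rewrite /pseries /series/= big_nat_recl//= a0 mul0r add0r mulr_sumr.
  by apply: eq_bigr => i _; rewrite exprS mulrCA.
have bcv z : z != 0 -> `|z| < rho -> pseries b z @ \oo --> z^-1 * limn (pseries a z).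
  move=> z0 zr; have -> : pseries b z = (fun k => z^-1 * pseries a z k.+1).
    by apply/funext => k; rewrite -bz mulKf.
  by apply: cvgMl_tmp; rewrite cvg_shiftS; exact: ca.
apply: (IH b) => [z zr|z /andP[z0 zd]].
  pose K := (`|z| + rho) / 2.
  have zK : `|z| < K by rewrite midf_lt.
  have K0 : 0 < K by exact: le_lt_trans zK.
  apply: (@is_cvg_pseries_inside _ _ K); last by rewrite (gtr0_norm K0).
  apply/cvgP/bcv; first exact: lt0r_neq0.
  by rewrite (gtr0_norm K0) midf_lt.
have zr : `|z| < rho by rewrite (gtr0_norm z0); exact: lt_le_trans dr.
rewrite (cvg_lim _ (bcv _ _ zr))//; last exact: lt0r_neq0.
by rewrite az ?mulr0// z0.
Qed.

(** Identity theorem: at the supremum of the points where [f] is not zero, the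
    power series of [f] vanishes on the right, hence identically. *)
Lemma real_analytic_eq0 f (delta : R) : 0 < delta ->
  (forall x, x <= 0 -> real_analytic_at f x) ->
  (forall x, `|x| < delta -> f x = 0) ->
  forall x, x <= 0 -> f x = 0.
Proof.
move=> d0 fan f0 x0 x00; apply: contrapT => /eqP fx0.
pose S := [set x | x0 <= x <= 0 /\ f x != 0].
have Sx0 : S x0 by split => //; rewrite lexx.
have hS : has_sup S by split; [exists x0|exists 0 => x [/andP[]]].
set s := sup S.
have x0s : x0 <= s by exact: (ub_le_sup hS.2).
have s0 : s <= 0 by apply: ge_sup; [exists x0|move=> x [/andP[]]].
have fS x : s < x -> x < delta -> f x = 0.
  move=> sx xd; have [x0'|xp] := leP x 0; last by apply: f0; rewrite gtr0_norm.
  apply: contrapT => /eqP fx; have := ub_le_sup hS.2 (_ : S x).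
  rewrite leNgt sx => /(_ _)/negP; apply => //.
  by split => //; rewrite x0' (le_trans x0s)// ltW.
have [a [rho r0 fa]] := fan _ s0.
have az : forall n, a n = 0.
  apply: (@pseries_right0 rho (Num.min rho delta)) => //.
  - by rewrite lt_min r0.
  - by move=> z zr; have := fa (z + s); rewrite addrK => /(_ zr)/cvgP.
  - move=> z /andP[z0]; rewrite lt_min => /andP[zr zd].
    have := fa (z + s); rewrite addrK (gtr0_norm z0) => /(_ zr)/cvg_lim -> //.
    by apply: fS; rewrite ?ltrDr//; apply: le_lt_trans zd; rewrite gerDl.
have fs x : `|x - s| < rho -> f x = 0.
  move=> /fa; have -> : pseries a (x - s) = cst 0.
    by apply/funext => n; rewrite /pseries /series/= big1// => i _; rewrite az mul0r.
  by move=> h; apply: (cvg_unique (@Rhausdorff R) h); exact: cvg_cst.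
have [x Sx sx] := sup_adherent r0 hS.
have xs : x <= s by exact: (ub_le_sup hS.2).
case: (Sx) => _ /eqP; apply; apply: fs.
by rewrite distrC ger0_norm ?subr_ge0// ltrBlDr -ltrBlDl.
Qed.

End real_power_series.

(** * The hypergeometric function on the negative half-line *)

Section real_restriction.
Context {R : realType}.
Local Notation Re := complex.Re.
Local Notation Im := complex.Im.

(** Only the restriction to the real axis of the continued function matters, so
    complex series are split into real and imaginary parts. *)
Lemma csums_Re_Im (v : nat -> R[i]) (l : R[i]) : csums v l ->
  series (fun n => Re (v n)) @ \oo --> Re l /\
  series (fun n => Im (v n)) @ \oo --> Im l.
Proof.
move=> vl; have ReE n : Re (series v n) = series (fun k => Re (v k)) n.
  by rewrite /series/=; elim/big_rec2: _ => // i x z _ <-; case: (v i) z => ? ? [].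
have ImE n : Im (series v n) = series (fun k => Im (v k)) n.
  by rewrite /series/=; elim/big_rec2: _ => // i x z _ <-; case: (v i) z => ? ? [].
have near_l (e : R) : 0 < e -> \forall n \near \oo, `|l - series v n| < e%:C.
  by move=> e0; move/cvgrPdist_lt : vl; apply; rewrite ltcR.
split; apply/cvgrPdist_lt => e /near_l; apply: filterS => n; rewrite -?ReE -?ImE.
  rewrite -ltcR; apply: le_lt_trans.
  by apply: le_trans (normc_ge_Re _); case: (l) (series v n) => ? ? [].
rewrite -ltcR normc_def; apply: le_lt_trans.
rewrite lecR -sqrtr_sqr ler_sqrt ?addr_ge0 ?sqr_ge0//.
by case: (l) (series v n) => ? ? [? ?]/=; rewrite lerDr sqr_ge0.
Qed.

Lemma Re_mul_real (w : R[i]) (x : R) : Re (w * x%:C) = Re w * x.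
Proof. by case: w => a b /=; rewrite mulr0 subr0. Qed.

Lemma Im_mul_real (w : R[i]) (x : R) : Im (w * x%:C) = Im w * x.
Proof. by case: w => a b /=; rewrite mulr0 add0r. Qed.

Lemma analytic_at_real (F : R[i] -> R[i]) (x0 : R) : analytic_at F x0%:C ->
  real_analytic_at (fun x => Re (F x%:C)) x0 /\
  real_analytic_at (fun x => Im (F x%:C)) x0.
Proof.
move=> [a [rho r0 Fa]]; split; [exists (fun n => Re (a n))|exists (fun n => Im (a n))];
  exists rho => // x xr.
  have /Fa/csums_Re_Im[+ _] : `|x%:C - x0%:C| < rho%:C.
    by rewrite -rmorphB/= normc_def/= expr0n/= addr0 sqrtr_sqr ltcR.
  rewrite /pseries; under eq_fun do rewrite -rmorphB -rmorphXn Re_mul_real.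
  exact.
have /Fa/csums_Re_Im[_ +] : `|x%:C - x0%:C| < rho%:C.
  by rewrite -rmorphB/= normc_def/= expr0n/= addr0 sqrtr_sqr ltcR.
rewrite /pseries; under eq_fun do rewrite -rmorphB -rmorphXn Im_mul_real.
exact.
Qed.

End real_restriction.

Section hypergeometric_real.
Context {R : realType}.
Local Notation Re := complex.Re.
Local Notation Im := complex.Im.
Variables (b : nat) (e : R) (F : R[i] -> R[i]).
Hypothesis F21 : is_2F1 b.+1%:R e%:C b.+2%:R F.

Let rpoch (s : R) k : R := \prod_(i < k) (s + i%:R).

Let pochE (s : R) k : poch s%:C k = (rpoch s k)%:C.
Proof.
rewrite /poch /rpoch rmorph_prod; apply: eq_bigr => i _.
by rewrite rmorphD rmorph_nat.
Qed.

Let coef k : R := rpoch b.+1%:R k * rpoch e k / rpoch b.+2%:R k / k`!%:R.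

Let rpoch_neq0 k : rpoch b.+2%:R k != 0.
Proof. by apply/prodf_neq0 => i _; rewrite -natrD pnatr_eq0 addSn. Qed.

Let rpoch_shift k : (k%:R + b.+1%:R) * rpoch b.+1%:R k = b.+1%:R * rpoch b.+2%:R k.
Proof.
elim: k => [|k IH]; first by rewrite /rpoch !big_ord0 add0r.
rewrite /rpoch !big_ord_recr/= -!/(rpoch _ _) !mulrA -IH -!natr1; ring.
Qed.

(** Multiplying by [k + b + 1] removes the ratio of the Pochhammer symbols of
    [b + 1] and [b + 2]. *)
Let coefE k : (k%:R + b.+1%:R) * coef k = b.+1%:R * (rpoch e k / k`!%:R).
Proof.
rewrite /coef !mulrA rpoch_shift; field.
by rewrite rpoch_neq0 pnatr_eq0 -lt0n fact_gt0.
Qed.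

Let pseries_coef x : `|x| < 1 ->
  pseries coef x @ \oo --> Re (F x%:C) /\ Im (F x%:C) = 0.
Proof.
move=> x1; have /(F21.1) : `|x%:C| < 1.
  by rewrite normc_def/= expr0n/= addr0 sqrtr_sqr ltcR.
have -> : (fun k => poch b.+1%:R k * poch e%:C k / poch b.+2%:R k *
    (x%:C ^+ k / k`!%:R)) = (fun k => (coef k * x ^+ k)%:C).
  apply/funext => k.
  rewrite -[b.+1%:R](rmorph_nat (real_complex R)) -[b.+2%:R](rmorph_nat (real_complex R)).
  rewrite -[k`!%:R](rmorph_nat (real_complex R)) !pochE /coef.
  by rewrite -!(rmorphM, fmorphV, rmorphXn)/=; congr _%:C; ring.
move=> /csums_Re_Im[? l]; split => //.
have h : series (fun k : nat => Im (coef k * x ^+ k)%:C) @ \oo --> (0 : R).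
  by apply: cvg_near_cst; near=> n; rewrite /series/= big1.
exact: (cvg_unique (@Rhausdorff R) l h).
Unshelve. all: by end_near. Qed.

Let f x := Re (F x%:C).

Let analytic_le0 (x : R) : x <= 0 -> analytic_at F x%:C.
Proof.
move=> x0; apply: F21.2; rewrite -[1]/(1%:C) lecR -ltNge.
by apply: le_lt_trans x0 ltr01.
Qed.

(** The coefficients are real, so the imaginary part vanishes on the unit disc,
    and elsewhere by the identity theorem. *)
Lemma hypergeometric_Im (x : R) : x <= 0 -> Im (F x%:C) = 0.
Proof.
apply: (@real_analytic_eq0 _ (fun x => Im (F x%:C)) 1 ltr01).
  by move=> y y0; have [] := analytic_at_real (analytic_le0 y0).
by move=> y /pseries_coef[].
Qed.

Let f_analytic (x : R) : x <= 0 -> real_analytic_at f x.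
Proof. by move=> x0; have [] := analytic_at_real (analytic_le0 x0). Qed.

Lemma hypergeometric_is_derive (x : R) : x <= 0 -> is_derive x 1 f (f^`()%classic x).
Proof. by move=> /f_analytic/real_analytic_is_derive. Qed.

Let g x := (0 + 1 * x) * f^`()%classic x + b.+1%:R * f x.

Let f_sum : pseries_sum f 0 1 coef.
Proof. by move=> x; rewrite subr0 => /pseries_coef[]. Qed.

(** The function [g = x f' + (b+1) f] has the coefficients of
    [(b+1) (1 - x)^(-e)], which satisfy the recurrence expressing
    [(1 - x) g' = e g]. *)
Let ode (x : R) : x <= 0 -> (1 + (-1) * x) * g^`()%classic x + (- e) * g x = 0.
Proof.
apply: (@real_analytic_eq0 _ (fun x => _) 1 ltr01) => [y y0|y y1].
  exact/real_analytic_operator/real_analytic_operator/f_analytic.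
have := @pseries_sum_operator _ _ _ _ _ 1 (-1) (- e)
  (@pseries_sum_operator _ _ _ _ _ 0 1 b.+1%:R f_sum).
move=> /(_ y); rewrite subr0 => /(_ y1).
set c := fun n => _; have c0 : c = cst 0.
  pose d k := b.+1%:R * (rpoch e k / k`!%:R).
  have dE n : (0 + 1 * 0) * pseries_diffs coef n +
      (1 * pseries_shift (pseries_diffs coef) n + b.+1%:R * coef n) = d n.
    rewrite /d -coefE !mulr0 !addr0 mul0r add0r mul1r mulrDl.
    by case: n => [|n]; rewrite /= ?mul0r.
  apply/funext => n; rewrite /c (funext dE) dE /= mulr0 addr0 mul1r.
  have -> : pseries_shift (pseries_diffs d) n = n%:R * d n.
    by case: n => [|n]; rewrite /= ?mul0r.
  rewrite /pseries_diffs /d /rpoch big_ord_recr/= -/(rpoch e n) factS natrM.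
  by field; rewrite nat1r !pnatr_eq0/= -lt0n fact_gt0.
rewrite c0 => h; apply: (cvg_unique (@Rhausdorff R) h).
apply: cvg_near_cst; near=> n; rewrite /pseries /series/= big1// => i _.
by rewrite mul0r.
Unshelve. all: by end_near. Qed.

Let g_is_derive (x : R) : x <= 0 -> is_derive x 1 g (g^`()%classic x).
Proof. by move=> x0; exact/real_analytic_is_derive/real_analytic_operator/f_analytic. Qed.

Let g0 : g 0 = b.+1%:R.
Proof.
rewrite /g mulr0 addr0 mul0r add0r.
have -> : f 0 = 1; last by rewrite mulr1.
have h : pseries coef 0 @ \oo --> f 0 by apply: (pseries_coef _).1; rewrite normr0.
apply: (cvg_unique (@Rhausdorff R) h) => /=; rewrite -cvg_shiftS.
apply: cvg_near_cst; near=> n; rewrite /pseries /series/= big_nat_recl//= expr0.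
rewrite big1 ?addr0 => [|i _]; last by rewrite expr0n mulr0.
by rewrite /coef /rpoch !big_ord0 !mulr1 !divr1.
Unshelve. all: by end_near. Qed.

(** By the differential equation, [g t * (1 - t) `^ e] is constant. *)
Lemma hypergeometric_ode (x : R) : x <= 0 ->
  x * f^`()%classic x + b.+1%:R * f x = b.+1%:R * (1 - x) `^ (- e).
Proof.
move=> x0; pose h t := g t * (1 - t) `^ e.
have omx (t : R) : t <= 0 -> 0 < 1 - t by move=> t0; rewrite subr_gt0 (le_lt_trans t0).
have dh (t : R) : t <= 0 -> is_derive t 1 h 0.
  move=> t0; have D1 : is_derive t (1 : R) (fun t => 1 - t) (-1).
    by rewrite -[X in is_derive _ _ _ X]add0r; apply: is_deriveB.
  have D2 := @is_derive1_comp _ (fun y => y `^ e) (fun t => 1 - t) t _ _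
    (is_derive1_powR e (omx t t0)) D1.
  have -> : 0 = g t *: (e * (1 - t) `^ (e - 1) * -1) +
      (1 - t) `^ e *: g^`()%classic t :> R.
    have -> : (1 - t) `^ e = (1 - t) `^ (e - 1) * (1 - t).
      rewrite -[in LHS](subrK 1 e) [LHS]powRD ?powRr1 ?ltW ?omx//.
      by apply/implyP => _; rewrite gt_eqF// omx.
    rewrite /GRing.scale/=.
    transitivity ((1 - t) `^ (e - 1) *
      ((1 + (-1) * t) * g^`()%classic t + (- e) * g t)); last by ring.
    by rewrite ode// mulr0.
  exact: is_deriveM (g_is_derive t0) D2.
have h0 : h x = h 0.
  have [||t _ /eqP] := @MVT_segment R h (cst 0) x 0 x0.
  - by move=> t; rewrite in_itv/= => /andP[_ /ltW/dh].
  - apply: derivable_within_continuous => t.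
    by rewrite in_itv/= => /andP[_ /dh[]].
  - by rewrite mul0r subr_eq0 => /eqP.
rewrite -[x in x * _]mul1r -[1 * x]add0r -/(g x) powRN.
move: h0; rewrite /h g0 subr0 powR1 mulr1 => <-.
by rewrite mulfK// gt_eqF// powR_gt0// omx.
Qed.

End hypergeometric_real.

Section euler_integral.
Context {R : realType}.
Local Notation leb := (@lebesgue_measure R).
Local Notation Re := complex.Re.
Variables (r : nat) (a c e : R) (F : R[i] -> R[i]).
Hypotheses (a_gt0 : 0 < a) (c_gt0 : 0 < c).
Hypothesis F21 : is_2F1 r.+1%:R e%:C r.+2%:R F.

Let affine_gt0 (t : R) : 0 <= t -> 0 < a + c * t.
Proof. by move=> t0; rewrite ltr_pwDl// mulr_ge0// ltW. Qed.

Lemma is_derive_affine_powR (s t : R) : 0 <= t ->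
  is_derive t 1 (fun t => (a + c * t) `^ s) (s * (a + c * t) `^ (s - 1) * c).
Proof.
move=> t0; have D : is_derive t (1 : R) (fun t => a + c * t) c.
  have D0 := is_deriveD (is_derive_cst a t (1 : R))
    (is_deriveZ c (is_derive_id t (1 : R))).
  by refine (is_derive_eq D0 _); rewrite add0r; exact: mulr1.
exact: @is_derive1_comp _ (fun y => y `^ s) _ t _ _
  (is_derive1_powR s (affine_gt0 t0)) D.
Qed.

Let h (t : R) := (a + c * t) `^ (- e).
Let g (t : R) := e * c * (a + c * t) `^ (- e - 1).
Let f x := Re (F x%:C).
Let z := c / a.

Lemma is_derive_affine_powRN (t : R) : 0 <= t -> is_derive t 1 h (- g t).
Proof.
move=> /(is_derive_affine_powR (- e)) D; apply: is_derive_eq D _.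
by rewrite /g; ring.
Qed.

Lemma within_continuous_affine_powRN : {within `[0, 1], continuous g}.
Proof.
apply: derivable_within_continuous => t; rewrite in_itv/= => /andP[t0 _].
have [+ _] := is_derive_mulr (e * c) (is_derive_affine_powR (- e - 1) t0).
by rewrite (_ : (fun _ => _) = g)//; apply/funext => x; exact: mulrC.
Qed.

(** By the differential equation, [t^(r+1) f (- z t)] has derivative
    [(r+1) t^r (1 + z t)^(-e)], which is [a^e] times the first term in the
    derivative of [t^(r+1) h t]. *)
Lemma euler_integral :
  (\int[leb]_(t in `[0%R, 1%R]) (g t * t ^+ r.+1)%:E =
   (a `^ (- e) * f (- c / a) - h 1)%:E)%E.
Proof.
pose A t := a `^ (- e) * (t ^+ r.+1 * f (- z * t)) - t ^+ r.+1 * h t.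
have z0 : 0 < z by rewrite divr_gt0.
transitivity (A 1 - A 0)%:E; last first.
  by rewrite /A !expr0n/= !mul0r mulr0 !subr0 !expr1n !mul1r mulr1 /z mulNr.
apply: integral_is_derive => // [t /andP[t0 _]|].
  have Dt : is_derive t 1 (fun t => t ^+ r.+1) (r.+1%:R * t ^+ r * 1).
    exact: (is_derive_exprn r.+1 (is_derive_id t (1 : R))).
  have zt0 : - z * t <= 0 by rewrite mulNr oppr_le0 mulr_ge0// ltW.
  have Dz : is_derive t (1 : R) (fun t => - z * t) (- z).
    refine (is_derive_eq (is_deriveZ (- z) (is_derive_id t (1 : R))) _).
    exact: mulr1.
  have Df := @is_derive1_comp _ f (fun t => - z * t) t _ _
    (hypergeometric_is_derive F21 zt0) Dz.
  have D := is_deriveB (is_deriveZ (a `^ (- e)) (is_deriveM Dt Df))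
    (is_deriveM Dt (is_derive_affine_powRN t0)).
  apply: is_derive_eq D _; rewrite /GRing.scale/=.
  have ode := hypergeometric_ode F21 zt0.
  have hE : h t = a `^ (- e) * (1 - (- z * t)) `^ (- e).
    rewrite -powRM ?(ltW a_gt0)//; last first.
      by rewrite subr_ge0 (le_trans zt0).
    rewrite /h; congr (_ `^ _); rewrite /z; field; exact: lt0r_neq0.
  rewrite hE.
  transitivity (a `^ (- e) * t ^+ r * (- z * t * f^`()%classic (- z * t) +
      r.+1%:R * f (- z * t) - r.+1%:R * (1 - (- z * t)) `^ (- e)) +
      g t * t ^+ r.+1); last by rewrite ode subrr mulr0 add0r.
  by rewrite exprS; ring.
apply: derivable_within_continuous => t; rewrite in_itv/= => /andP[t0 _].
have Dg := is_derive_mulr (e * c) (is_derive_affine_powR (- e - 1) t0).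
have Dt : is_derive t 1 (fun t => t ^+ r.+1) (r.+1%:R * t ^+ r * 1).
  exact: (is_derive_exprn r.+1 (is_derive_id t (1 : R))).
have [+ _] := is_deriveM Dg Dt.
rewrite (_ : (fun _ => _) * _ = fun t => g t * t ^+ r.+1)//.
by apply/funext => x; rewrite /g [e * c * _]mulrC.
Qed.

End euler_integral.

(** * Measure of the exceedance events *)

Section exceedance_measure.
Context {R : realType} {r : nat} d (T : measurableType d) (P : probability T R).
Variables (U : 'I_r.+1 -> {RV P >-> R})
  (nu : {measure set (measurableTypeR R) -> \bar R}) (alpha a c kappa : R)
  (B : set (cadlag R)).
Hypotheses (alpha_gt0 : 0 < alpha) (a_gt0 : 0 < a) (ac_gt0 : 0 < a + c)
  (kappa_gt0 : 0 < kappa).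
Hypotheses (iidU : iid_uniform U) (nuP : is_nu alpha nu).

Let level (m : R) := a + c * (if 0 < c then m else 1).

Hypothesis BP : forall (u : 'I_r.+1 -> R) (y : r.+1.-tuple R),
  (forall i, 0 < u i < 1) -> injective u -> ordered_orthant y ->
  B (step_path u y) <->
  level (\big[Num.max/0]_i u i) / kappa <= tnth y ord_max.

Let e := r.+1%:R * alpha.
Let K := kappa `^ e / r.+1`!%:R.

Let level_gt0 m : 0 <= m -> 0 < level m.
Proof.
move=> m0; rewrite /level; case: ifP => c0; last by rewrite mulr1.
by rewrite ltr_pwDl// mulr_ge0// ltW.
Qed.

Let K_ge0 : 0 <= K.
Proof. by rewrite divr_ge0// powR_ge0. Qed.

(** Outside a null set the jump times are distinct and interior, which is where
    the exceedance event is described by [BP]. *)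
Lemma Cmeas_integral : exists N : set T,
  [/\ measurable N, P N = 0%E, forall w, ~ N w -> maxU U w <= 1 &
   Cmeas U nu B =
   (\int[P]_(w in ~` N) (K * level (maxU U w) `^ (- e))%:E)%E].
Proof.
have [N [mN N0 UN]] := ae_distinct_in01 iidU.
have goodN w : ~ N w -> (forall i, 0 < U i w < 1) /\ injective (U ^~ w).
  by move=> nN; apply: contrapT => /UN.
exists N; split => // [w /goodN[U01 _]|].
  by apply: bigmax_le => // i _; have /andP[_ /ltW] := U01 i.
apply: ge0_integral_off_null => //.
- by move=> w; exact: product_power_ge0.
- by move=> w _; rewrite lee_fin mulr_ge0// powR_ge0.
- apply/measurable_EFinP; apply: measurable_funM; first exact: measurable_cst.
  apply: (measurableT_comp (measurable_powR (- e))).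
  apply: measurable_funD; first exact: measurable_cst.
  apply: measurable_funM; first exact: measurable_cst.
  case: (0 < c); last exact: measurable_cst.
  exact/measurable_funTS/measurable_maxU.
- move=> w /goodN[U01 UI].
  have M0 : 0 <= maxU U w by exact: bigmax_ge_id.
  rewrite (@nu_ordered_ge_last _ alpha nu alpha_gt0 nuP r
    (level (maxU U w) / kappa)).
  + rewrite -/e powRM ?invr_ge0 ?(ltW kappa_gt0) ?(ltW (level_gt0 M0))//.
    rewrite -powR_inv1 ?(ltW kappa_gt0)// -powRrM mulN1r opprK /K.
    by congr _%:E; ring.
  + by rewrite divr_gt0// level_gt0.
  + by move=> y yo; exact: BP.
Qed.

Lemma Cmeas_neg : c < 0 -> Cmeas U nu B = (K * (a + c) `^ (- e))%:E.
Proof.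
move=> c0; have [N [mN N0 _ ->]] := Cmeas_integral.
rewrite /level ltNge (ltW c0)/= mulr1 integral_cst; last exact: measurableC.
by rewrite -[X in (_ * X)%E]/(P (~` N)) probability_setC// N0 sube0 mule1.
Qed.

Lemma Cmeas_pos (F : R[i] -> R[i]) : 0 < c ->
  is_2F1 r.+1%:R e%:C r.+2%:R F ->
  Cmeas U nu B = (K * (a `^ (- e) * complex.Re (F (- c / a)%:C)))%:E.
Proof.
move=> c0 F21; have [N [mN N0 M1 ->]] := Cmeas_integral.
have e0 : 0 < e by rewrite mulr_gt0.
pose h (t : R) := (a + c * t) `^ (- e).
pose g (t : R) := e * c * (a + c * t) `^ (- e - 1).
rewrite /level c0.
transitivity (K%:E * \int[P]_(w in ~` N) (h (maxU U w))%:E)%E.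
  rewrite -ge0_integralZl_EFin//.
  - exact: measurableC.
  - by move=> w _; rewrite lee_fin powR_ge0.
  - apply/measurable_EFinP; apply: (measurableT_comp (measurable_powR (- e))).
    apply: measurable_funD; first exact: measurable_cst.
    apply: measurable_funM; first exact: measurable_cst.
    exact/measurable_funTS/measurable_maxU.
have -> : (\int[P]_(w in ~` N) (h (maxU U w))%:E = (h 1)%:E +
    \int[lebesgue_measure]_(t in `[0%R, 1%R]) (g t * t ^+ r.+1)%:E)%E.
  apply: (expectation_maxU iidU) => //.
  - by move=> t /andP[t0 _]; exact: is_derive_affine_powRN.
  - exact: within_continuous_affine_powRN.
  - move=> t /andP[t0 _]; apply: mulr_ge0; last exact: powR_ge0.
    by rewrite mulr_ge0 ?ltW.
  - exact: powR_ge0.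
rewrite (euler_integral a_gt0 c0 F21) -EFinD -EFinM.
by congr _%:E; rewrite /h; ring.
Qed.

End exceedance_measure.

Theorem lemma3p8 (R : realType) (r : nat) (alpha a c : R)
  (d : measure_display) (T : measurableType d) (P : probability T R)
  (U : 'I_r.+1 -> {RV P >-> R}) (nu : {measure set (measurableTypeR R) -> \bar R})
  (F : R[i] -> R[i]) :
  (1 <= r)%N -> 1 < alpha -> 0 < a -> 0 < a + c ->
  iid_uniform U -> is_nu alpha nu ->
  is_2F1 r.+1%:R (r.+1%:R * alpha)%:C r.+2%:R F ->
  let CL := Cmeas U nu (exceedL r c a) in
  let CE := Cmeas U nu (exceedE r c a) in
  (0 < c -> exists h : R, F (- c / a)%:C = h%:C /\
     CL = (r.+1`!%:R^-1 * (a `^ (- (r.+1%:R * alpha)) * h))%:E /\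
     CE = (r.+1%:R `^ (r.+1%:R * alpha) / r.+1`!%:R *
             (a `^ (- (r.+1%:R * alpha)) * h))%:E) /\
  (c < 0 ->
     CL = (r.+1`!%:R^-1 * (a + c) `^ (- (r.+1%:R * alpha)))%:E /\
     CE = (r.+1%:R `^ (r.+1%:R * alpha) / r.+1`!%:R *
             (a + c) `^ (- (r.+1%:R * alpha)))%:E).
Proof.
move=> _ alpha1 a0 ac0 iidU nuP F21 CL CE.
have alpha0 : 0 < alpha by exact: lt_trans alpha1.
have KL : 1 `^ (r.+1%:R * alpha) / r.+1`!%:R = r.+1`!%:R^-1 :> R.
  by rewrite powR1 mul1r.
have BL (u : 'I_r.+1 -> R) (y : r.+1.-tuple R) : c != 0 ->
    (forall i, 0 < u i < 1) -> injective u -> ordered_orthant y ->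
    exceedL r c a (step_path u y) <->
    (a + c * (if 0 < c then \big[Num.max/0]_i u i else 1)) / 1 <= tnth y ord_max.
  by move=> c0 u01 uI [y0 yd]; rewrite divr1; exact: exceedL_step_path.
have BE (u : 'I_r.+1 -> R) (y : r.+1.-tuple R) : c != 0 ->
    (forall i, 0 < u i < 1) -> injective u -> ordered_orthant y ->
    exceedE r c a (step_path u y) <->
    (a + c * (if 0 < c then \big[Num.max/0]_i u i else 1)) / r.+1%:R
      <= tnth y ord_max.
  by move=> c0 u01 uI [y0 yd]; exact: exceedE_step_path.
split=> c0; last first.
  have cN0 : c != 0 by rewrite lt_eqF.
  split; first by rewrite -KL; apply: Cmeas_neg => // u y; exact: BL.
  by apply: Cmeas_neg => // u y; exact: BE.
have cN0 : c != 0 by rewrite gt_eqF.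
exists (complex.Re (F (- c / a)%:C)); split.
  have x0 : - c / a <= 0 by rewrite mulNr oppr_le0 divr_ge0 ?ltW.
  by case: (F _) (hypergeometric_Im F21 x0) => x y /= ->.
split; first by rewrite -KL; apply: Cmeas_pos => // u y; exact: BL.
by apply: Cmeas_pos => // u y; exact: BE.
Qed.
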